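(* Let $P$ be a $C^\infty$ manifold without boundary. For every Borel measure $\mu$ on $P$ and every distribution $\eta$ on $P$, there exists a family $(\mu_s)_s$ of signed Borel measures on $P$ with $$\mu_0=\mu\quad\text{and}\quad\left.\frac{d\mu_s}{ds}\right|_{s=0}=\eta.$$
   Context: $C^\infty_c(P)$ is the space of smooth real-valued compactly supported functions on $P$. A distribution on $P$ is a linear functional $\eta:C^\infty_c(P)\to\mathbb{R}$ whose pushforward by every chart is a distribution in the usual sense on an open subset of Euclidean space. Measures (positive or signed) are regarded as determining distributions, i.e. they are locally finite (a signed measure is a functional locally given by a finite signed Borel measure). The family $(\mu_s)$ is parameterized by $s$ in an open interval containing $0$, and $\frac{d\mu_s}{ds}\big|_{s=0}=\eta$ means that $\frac{d}{ds}\big|_{s=0}\int f\,d\mu_s=\langle\eta,f\rangle$ for every $f\in C^\infty_c(P)$. *)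

(* Defs.v *)
From HB Require Import structures.
From mathcomp Require Export all_boot all_order all_algebra.
From mathcomp Require Export all_classical all_reals all_analysis.

Set Implicit Arguments.
Unset Strict Implicit.
Unset Printing Implicit Defensive.

Export Order.TTheory GRing.Theory Num.Theory.
Export numFieldNormedType.Exports.

#[global] Open Scope classical_set_scope.
#[global] Open Scope ring_scope.

Section euclidean.
Context {R : realType} {n : nat}.
Implicit Types (U V K : set 'rV[R]_n) (f : 'rV[R]_n -> R).

Definition iter_partial (s : seq 'I_n) f : 'rV[R]_n -> R :=
  foldr (fun i g => 'D_(delta_mx ord0 i) g) f s.

(* Meant for open U, where it only depends on the values of f on U. *)
Definition smooth_on U f : Prop :=
  forall (s : seq 'I_n) (x : 'rV[R]_n), U x ->
    {for x, continuous (iter_partial s f)} /\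
    forall i, derivable (iter_partial s f) x (delta_mx ord0 i).

End euclidean.

Definition fsupport {R : realType} {T : topologicalType} (f : T -> R) : set T :=
  closure [set x | f x != 0].

Definition linear_on {R : realType} {T : Type} (D : set (T -> R))
    (L : (T -> R) -> R) : Prop :=
  forall (a : R) (f g : T -> R), D f -> D g ->
    L (fun x => a * f x + g x) = a * L f + L g.

Section euclidean_distributions.
Context {R : realType} {n : nat}.

(* The elements of C^oo_c(V), V open, extended by 0 to the whole space. *)
Definition eucl_test_function (V : set 'rV[R]_n) : set ('rV[R]_n -> R) :=
  [set f : 'rV[R]_n -> R | [/\ smooth_on setT f, compact (fsupport f) & fsupport f `<=` V]].

(* On each compact K, L is bounded by a C^N norm; the mixed partial derivatives
   of order k are enumerated by k-tuples of directions, so each multi-index is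
   counted several times, which only affects the constant C. *)
Definition eucl_distribution (V : set 'rV[R]_n) (L : ('rV[R]_n -> R) -> R) :
    Prop :=
  linear_on (eucl_test_function V) L /\
  forall K : set 'rV[R]_n, compact K -> K `<=` V ->
    exists (C : R) (N : nat), forall f,
      eucl_test_function V f -> fsupport f `<=` K ->
      `|L f| <= C * \sum_(k < N.+1) \sum_(s : k.-tuple 'I_n)
                      sup [set `|iter_partial s f x| | x in K].

End euclidean_distributions.

(* Only the values of chart_map on chart_dom, and of chart_inv on the image of
   chart_dom, are meaningful. *)
Record chart (R : realType) (n : nat) (P : topologicalType) := Chart {
  chart_dom : set P ;
  chart_map : P -> 'rV[R]_n ;
  chart_inv : 'rV[R]_n -> P ;
  chart_dom_open : open chart_dom ;
  chart_img_open : open (chart_map @` chart_dom) ;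
  chart_mapK : forall x, chart_dom x -> chart_inv (chart_map x) = x ;
  chart_map_cont : forall x, chart_dom x -> {for x, continuous chart_map} ;
  chart_inv_cont : forall y, (chart_map @` chart_dom) y ->
    {for y, continuous chart_inv} }.

Definition chart_img {R : realType} {n : nat} {P : topologicalType}
    (c : chart R n P) : set 'rV[R]_n :=
  chart_map c @` chart_dom c.

Definition smooth_transition {R : realType} {n : nat} {P : topologicalType}
    (c c' : chart R n P) : Prop :=
  forall i : 'I_n, smooth_on (chart_map c @` (chart_dom c `&` chart_dom c'))
    (fun y => chart_map c' (chart_inv c y) ord0 i).

(* A smooth structure is a maximal smooth atlas. *)
Record smooth_structure (R : realType) (n : nat) (P : topologicalType) :=
  SmoothStructure {
  charts : set (chart R n P) ;
  charts_cover : forall x : P, exists2 c, charts c & chart_dom c x ;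
  charts_compat : forall c c', charts c -> charts c' -> smooth_transition c c' ;
  charts_max : forall c,
    (forall c', charts c' -> smooth_transition c c' /\ smooth_transition c' c) ->
    charts c }.

(* The points of P, equipped with the Borel sigma-algebra. *)
Notation borel P := (g_sigma_algebraType (@open P)).

Section manifold.
Context {R : realType} {n : nat} {P : ptopologicalType}.
Variable S : smooth_structure R n P.

(* C^oo_c(P) *)
Definition test_function : set (P -> R) :=
  [set f : P -> R | (forall c, charts S c -> smooth_on (chart_img c) (f \o chart_inv c))
           /\ compact (fsupport f)].

(* The pushforward of eta by c sends f to the value of eta at f \o c, the
   latter being extended by 0 outside the domain of c. *)
Definition chart_pushforward (c : chart R n P) (eta : (P -> R) -> R)
    (f : 'rV[R]_n -> R) : R :=
  eta ((f \o chart_map c) \_ (chart_dom c)).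

(* Functionals are total on P -> R, but only their values on test functions are
   meaningful. *)
Definition distribution (eta : (P -> R) -> R) : Prop :=
  linear_on test_function eta /\
  forall c, charts S c ->
    eucl_distribution (chart_img c) (chart_pushforward c eta).

Definition locally_finite_measure (mu : {measure set (borel P) -> \bar R}) :
    Prop :=
  forall x : P, exists U : set P, [/\ open U, U x & (mu U < +oo)%E].

(* The integral against a finite signed measure, through its Jordan
   decomposition (which does not depend on the chosen Hahn decomposition). *)
Definition charge_integral (nu : {charge set (borel P) -> \bar R})
    (f : P -> R) : R :=
  let hP := cid (Hahn_decomposition nu) in
  let hN := cid (projT2 hP) in
  let nuPN := projT2 hN in
  \int[jordan_pos nuPN]_x f x - \int[jordan_neg nuPN]_x f x.

(* A (locally finite) signed Borel measure, as a functional on C^oo_c(P) that is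
   locally given by a finite signed Borel measure. *)
Definition signed_measure (m : (P -> R) -> R) : Prop :=
  linear_on test_function m /\
  forall x : P, exists U : set P, [/\ open U, U x &
    exists nu : {charge set (borel P) -> \bar R}, forall f,
      test_function f -> fsupport f `<=` U -> m f = charge_integral nu f].

End manifold.

(* Main.v *)
From HB Require Import structures.
Require Import Defs.
From mathcomp Require Import ring lra finmap measurable_realfun.

(** Every distribution is a pointwise limit of finite combinations of point
    masses, and this is all that the theorem requires.  Suppose that [T_m] is
    such a combination for every [m] and that [T_m f] tends to [eta f] for every
    test function [f].  With [m(s)] an integer larger than [1 / |s|], the family
    [mu_s = mu + s T_m(s)] consists of locally finite signed measures, equals
    [mu] at [s = 0], and has difference quotient
    [(mu_s f - mu_0 f) / s = T_m(s) f], which tends to [eta f] as [s] tends to 0.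

    To find [T_m], consider first a distribution [L] on an open set of a
    Euclidean space and a test function [F] supported in a small ball.  Let
    [B_m F] be the multivariate Bernstein polynomial of [F] on a cube around the
    ball and [kappa] a cutoff equal to 1 on the ball.  All partial derivatives
    of [B_m F] converge uniformly to those of [F] on the cube
    ([bernstein_cvg]); a distribution is bounded by finitely many derivatives
    on a compact set, so [L (kappa B_m F)] tends to [L F].  But
    [B_m F = \sum_j F(x_j) w_j] samples [F] at finitely many nodes, so
    [L (kappa B_m F) = \sum_j L(kappa w_j) F(x_j)] is a combination of point
    masses evaluated at [F] ([eucl_distribution_approx]).

    Bernstein polynomials are handled as expectations: [B_m F (x)] is the mean
    of [F] at the end of a random walk on a grid whose drift leads to [x].
    Differentiating in [x] removes one step of the walk and replaces [F] by its
    difference quotient along that step ([is_derive_walk]).  By the mean value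
    theorem an iterated difference quotient is the corresponding partial
    derivative at a nearby point ([fdiffs_MVT]), and the variance of the walk
    tends to 0 ([walk_variance]), so the mean of this derivative tends to its
    value at [x].

    On the manifold, countably many charts carry bumps [th_i] such that every
    compact set is covered by finitely many of the regions where some [th_i] is
    1.  The functions [chi_i = th_i \prod_(j < i) (1 - th_j)] then satisfy
    [f = \sum_(i < m) chi_i f] for every test function [f] and every large [m],
    with [chi_i f = 0] for all [i >= m].  Applying the Euclidean result to the
    first [m] pieces gives [T_m] ([distribution_dirac_cvg]). *)

Set Implicit Arguments.
Unset Strict Implicit.
Unset Printing Implicit Defensive.

Local Notation e_ i := (delta_mx ord0 i).

(** * Smooth functions on open sets *)

Section smooth_calculus.
Context {R : realType} {n : nat}.
Implicit Types (U V K : set 'rV[R]_n) (f g : 'rV[R]_n -> R) (i : 'I_n) (x : 'rV[R]_n).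

Definition regular_on U f : Prop := forall x, U x ->
  {for x, continuous f} /\ forall i, derivable f x (e_ i).

(** Smoothness up to order [N] along a recursion that differentiates first:
    the derivative of a product or of a composite is a sum of products, so
    that stability under these operations is an induction on [N]. *)
Fixpoint ck_on N U f : Prop :=
  regular_on U f /\ if N is N'.+1 then forall i, ck_on N' U ('D_(e_ i) f) else True.

Lemma iter_partial_cat s t f :
  iter_partial (s ++ t) f = iter_partial s (iter_partial t f).
Proof. exact: foldr_cat. Qed.

Lemma iter_partial_rcons s i f :
  iter_partial (rcons s i) f = iter_partial s ('D_(e_ i) f).
Proof. by rewrite -cats1 iter_partial_cat. Qed.

Lemma ck_onP N U f : ck_on N U f <->
  forall s : seq 'I_n, (size s <= N)%N -> regular_on U (iter_partial s f).
Proof.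
elim: N f => [|N IH] f /=.
  split=> [[h _] [|i s] ss|h]; [exact: h|by []|].
  by split; [exact: (h [::])|].
split=> [[h hi] s|h].
  case/lastP: s => [_|s i]; first exact: h.
  by rewrite size_rcons iter_partial_rcons => /((IH _).1 (hi i)).
split; first exact: (h [::]).
by move=> i; apply/IH => s ss; rewrite -iter_partial_rcons; apply: h; rewrite size_rcons.
Qed.

Lemma smooth_onP U f : smooth_on U f <-> forall N, ck_on N U f.
Proof.
split=> [h N|h s x Ux]; first by apply/ck_onP => s _ x; exact: h.
by have /ck_onP/(_ s (leqnn _)) := h (size s); exact.
Qed.

Lemma ck_on_le N M U f : (M <= N)%N -> ck_on N U f -> ck_on M U f.
Proof.
move=> MN /ck_onP h; apply/ck_onP => s sM; apply: h; exact: leq_trans MN.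
Qed.

Lemma smooth_on_partial U f i : smooth_on U f -> smooth_on U ('D_(e_ i) f).
Proof.
by move=> h s x Ux; rewrite -iter_partial_rcons; exact: h.
Qed.

Lemma smooth_on_iter U f s : smooth_on U f -> smooth_on U (iter_partial s f).
Proof. by move=> h t x Ux; rewrite -iter_partial_cat; exact: h. Qed.

Lemma smooth_on_continuous U f x : smooth_on U f -> U x -> {for x, continuous f}.
Proof. by move=> h Ux; have [] := h [::] x Ux. Qed.

Lemma smooth_on_derivable U f x i : smooth_on U f -> U x -> derivable f x (e_ i).
Proof. by move=> h Ux; have [_] := h [::] x Ux; exact. Qed.

Lemma open_near U (x : 'rV[R]_n) f g : open U -> U x -> (forall y, U y -> f y = g y) ->
  {near x, f =1 g}.
Proof.
move=> oU Ux fg; near=> y; apply: fg; near: y.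
exact: open_nbhs_nbhs.
Unshelve. all: by end_near. Qed.

Lemma eq_on_partial U f g i : open U -> (forall y, U y -> f y = g y) ->
  forall y, U y -> 'D_(e_ i) f y = 'D_(e_ i) g y.
Proof. by move=> oU fg y Uy; apply: near_eq_derive; exact: open_near fg. Qed.

Lemma eq_on_iter U f g s : open U -> (forall y, U y -> f y = g y) ->
  forall y, U y -> iter_partial s f y = iter_partial s g y.
Proof.
by move=> oU fg; elim: s => //= i s IH; apply: eq_on_partial.
Qed.

Lemma regular_on_ext U f g : open U -> (forall y, U y -> f y = g y) ->
  regular_on U f -> regular_on U g.
Proof.
move=> oU fg h x Ux; have [cf df] := h x Ux; split.
  rewrite /prop_for /continuous_at -(fg _ Ux).
  have fgn : {near nbhs x, f =1 g} by exact: open_near Ux fg.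
  exact: cvg_trans (near_eq_cvg fgn) cf.
by move=> i; apply: (near_eq_derivable _ (df i)); exact: open_near Ux fg.
Qed.

Lemma ck_on_ext N U f g : open U -> (forall y, U y -> f y = g y) ->
  ck_on N U f -> ck_on N U g.
Proof.
move=> oU fg /ck_onP h; apply/ck_onP => s sN.
by apply: regular_on_ext (h s sN) => // y Uy; exact: (eq_on_iter s oU fg).
Qed.

Lemma smooth_on_ext U f g : open U -> (forall y, U y -> f y = g y) ->
  smooth_on U f -> smooth_on U g.
Proof.
by move=> oU fg /smooth_onP h; apply/smooth_onP => N; exact: ck_on_ext (h N).
Qed.

Lemma smooth_on_sub U V f : V `<=` U -> smooth_on U f -> smooth_on V f.
Proof. by move=> VU h s x /VU; exact: h. Qed.

Lemma smooth_on_union U V f : smooth_on U f -> smooth_on V f -> smooth_on (U `|` V) f.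
Proof. by move=> hU hV s x [/hU|/hV]; exact. Qed.

Lemma ck_on_add N U f g : open U -> ck_on N U f -> ck_on N U g ->
  ck_on N U (fun x => f x + g x).
Proof.
move=> oU; elim: N f g => [|N IH] f g [hf hfi] [hg hgi]; have h : regular_on U (fun x => f x + g x).
- move=> x Ux; have [cf df] := hf x Ux; have [cg dg] := hg x Ux.
  by split=> [|i]; [exact: continuousD|exact: derivableD].
- by [].
- move=> x Ux; have [cf df] := hf x Ux; have [cg dg] := hg x Ux.
  by split=> [|i]; [exact: continuousD|exact: derivableD].
split=> // i; apply: ck_on_ext (IH _ _ (hfi i) (hgi i)) => // y Uy.
have [_ df] := hf y Uy; have [_ dg] := hg y Uy.
by rewrite -deriveD.
Qed.

Lemma ck_on_mul N U f g : open U -> ck_on N U f -> ck_on N U g ->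
  ck_on N U (fun x => f x * g x).
Proof.
move=> oU.
have reg f' g' : regular_on U f' -> regular_on U g' -> regular_on U (fun x => f' x * g' x).
  move=> hf hg x Ux; have [cf df] := hf x Ux; have [cg dg] := hg x Ux.
  by split=> [|i]; [exact: continuousM|exact: derivableM].
elim: N f g => [|N IH] f g hf hg; have [rf hfi] := hf; have [rg hgi] := hg.
  by split; [exact: reg|].
split; first exact: reg.
move=> i; apply: (@ck_on_ext _ _ (fun y => f y * 'D_(e_ i) g y + g y * 'D_(e_ i) f y)) => //.
  move=> y Uy; have [_ df] := rf y Uy; have [_ dg] := rg y Uy.
  exact/esym/(deriveM (df i) (dg i)).
apply: ck_on_add => //; apply: IH; by [exact: hfi|exact: hgi|exact: ck_on_le hf|exact: ck_on_le hg].
Qed.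

Lemma ck_on_cst N U (c : R) : ck_on N U (fun=> c).
Proof.
have reg (c' : R) : regular_on U (fun=> c').
  by move=> x _; split=> [|i]; [exact: cst_continuous|exact: derivable_cst].
elim: N c => [|N IH] c; split=> // i.
rewrite (_ : 'D_(e_ i) _ = fun=> 0) //.
by apply/funext => x; rewrite -[RHS](derive_cst c x (e_ i)).
Qed.

(** Univariate smoothness, given by the whole sequence of derivatives, so that
    differentiating under a composition only shifts an index. *)
Definition smooth1 (p : R -> R) : Prop := exists2 G : nat -> R -> R,
  G 0%N = p & forall k (x : R), is_derive x (1 : R) (G k) (G k.+1 x).

(** The restriction of [f] to a line is a function of one variable, so the
    univariate chain rule applies although [f] has only directional
    derivatives. *)
Lemma is_derive_comp_dir (p : R -> R) f x (v : 'rV[R]_n) (dp : R) :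
  is_derive (f x) (1 : R) p dp -> derivable f x v ->
  is_derive x v (fun y => p (f y)) (dp * 'D_v f x).
Proof.
move=> hp hf.
pose g (h : R) := f (h *: v + x).
have g0 : g 0 = f x by rewrite /g scale0r add0r.
have hp' : is_derive (g 0) 1 p dp by rewrite g0.
have E (q : 'rV[R]_n -> R) : 'D_1 (fun h : R => q (h *: v + x)) 0 = 'D_v q x.
  rewrite /derive; set g1 := fun h => h^-1 *: _; set g2 := fun h => h^-1 *: _.
  suff -> : g1 = g2 by [].
  rewrite funeqE /g1 /g2 => h /=.
  by rewrite addr0 scale0r add0r [_%:A]mulr1.
have hg : is_derive (0 : R) (1 : R) g ('D_v f x).
  by apply: DeriveDef; [exact/(derivable1P f x v).1|exact: E].
have [h1 h2] := is_derive1_comp hp' hg.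
apply: DeriveDef; first by apply/derivable1P.
by rewrite -h2 -E.
Qed.

Lemma ck_on_comp N U f (p : R -> R) : open U -> smooth1 p -> ck_on N U f ->
  ck_on N U (fun x => p (f x)).
Proof.
move=> oU [G <-{p} dG] hf.
suff: forall k, ck_on N U (fun x => G k (f x)) by exact.
have reg k f' : regular_on U f' -> regular_on U (fun x => G k (f' x)).
  move=> h x Ux; have [cf df] := h x Ux; split.
    apply: (@continuous_comp _ _ _ f' (G k)) => //.
    apply: differentiable_continuous; apply/derivable1_diffP.
    by have [] := dG k (f' x).
  by move=> i; have [] := is_derive_comp_dir (dG k (f' x)) (df i).
elim: N f hf => [|N IH] f [rf hf] k.
  by split; [exact: reg|].
split=> [|i]; first exact: reg. apply: (@ck_on_ext _ _ (fun y => G k.+1 (f y) * 'D_(e_ i) f y)) => //.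
  move=> y Uy; have [_ df] := rf y Uy.
  by have [_ ->] := is_derive_comp_dir (dG k (f y)) (df i).
apply: ck_on_mul => //.
  by apply: IH; apply: (@ck_on_le N.+1).
exact: hf.
Qed.

Lemma smooth_on_add U f g : open U -> smooth_on U f -> smooth_on U g ->
  smooth_on U (fun x => f x + g x).
Proof.
by move=> oU /smooth_onP hf /smooth_onP hg; apply/smooth_onP => N; exact: ck_on_add.
Qed.

Lemma smooth_on_mul U f g : open U -> smooth_on U f -> smooth_on U g ->
  smooth_on U (fun x => f x * g x).
Proof.
by move=> oU /smooth_onP hf /smooth_onP hg; apply/smooth_onP => N; exact: ck_on_mul.
Qed.

Lemma smooth_on_cst U (c : R) : smooth_on U (fun=> c).
Proof. by apply/smooth_onP => N; exact: ck_on_cst. Qed.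

Lemma smooth_on_comp U f (p : R -> R) : open U -> smooth1 p -> smooth_on U f ->
  smooth_on U (fun x => p (f x)).
Proof.
by move=> oU sp /smooth_onP hf; apply/smooth_onP => N; exact: ck_on_comp.
Qed.

Lemma smooth_on_sum U (I : Type) (r : seq I) (F : I -> 'rV[R]_n -> R) : open U ->
  (forall k, smooth_on U (F k)) -> smooth_on U (fun x => \sum_(k <- r) F k x).
Proof.
move=> oU h; elim: r => [|k r IH].
  by apply: (smooth_on_ext oU _ (@smooth_on_cst U 0)) => // y _; rewrite big_nil.
apply: (smooth_on_ext oU _ (smooth_on_add oU (h k) IH)) => // y _.
by rewrite big_cons.
Qed.

Lemma is_derive_coord (i j : 'I_n) x :
  is_derive x (e_ j) (fun v : 'rV[R]_n => v ord0 i) (i == j)%:R.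
Proof.
apply: DeriveDef; first exact/diff_derivable/differentiable_coord.
rewrite /derive; apply: lim_near_cst => //; near=> h.
have h0 : h != 0 by near: h; exact: nbhs_dnbhs_neq.
by rewrite /= !mxE eqxx /= addrK -[LHS]/(_ * _) mulrA mulVf // mul1r eq_sym.
Unshelve. all: by end_near. Qed.

Lemma smooth_on_coord U i : open U -> smooth_on U (fun v : 'rV[R]_n => v ord0 i).
Proof.
move=> oU; apply/smooth_onP.
have reg : regular_on U (fun v : 'rV[R]_n => v ord0 i).
  move=> x _; split=> [|j]; first exact: coord_continuous.
  by have [] := is_derive_coord i j x.
case=> [|N]; split=> // j.
rewrite (_ : 'D_(e_ j) _ = fun=> ((i == j)%:R : R)); first exact: ck_on_cst.
by apply/funext => x; have [_ ->] := is_derive_coord i j x.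
Qed.

End smooth_calculus.

(** * The Bernstein random walk *)

Section walk.
Context {R : realType} {n : nat}.
Variables (a : 'rV[R]_n) (w : R).
Hypothesis w_gt0 : 0 < w.
Implicit Types (f g : 'rV[R]_n -> R) (i k : 'I_n) (x y z : 'rV[R]_n) (h : R).

(** The affine coordinate of [x] along the side [k] of the cube with corner
    [a] and side [w]: it lies in [[0, 1]] exactly when [x] does not leave the
    cube in that direction. *)
Definition bary k x : R := (x ord0 k - a ord0 k) / w.

(** The mean of [f] at the end of a random walk that starts at [y] and, for each
    direction [k] listed in [d], moves by [h] along [k] with probability
    [bary k x] and stays put otherwise.  If every direction is listed [m] times,
    [h = w / m] and [y = a], this is the tensor Bernstein polynomial of degree
    [m] of [f] on the cube, as a function of [x].  In this form positivity,
    variance and differentiation are inductions on [d]. *)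
Fixpoint walk h (d : seq 'I_n) f x y : R :=
  if d is k :: d' then
    (1 - bary k x) * walk h d' f x y + bary k x * walk h d' f x (y + h *: e_ k)
  else f y.

Lemma walk_lin h d (c c' : R) f g x y :
  walk h d (fun z => c * f z + c' * g z) x y =
  c * walk h d f x y + c' * walk h d g x y.
Proof. by elim: d y => //= k d IH y; rewrite !IH; ring. Qed.

Lemma walk_cst h d (c : R) x y : walk h d (fun=> c) x y = c.
Proof. by elim: d y => //= k d IH y; rewrite !IH; ring. Qed.

Lemma walk_sum h d (I : Type) (r : seq I) (F : I -> 'rV[R]_n -> R) x y :
  walk h d (fun z => \sum_(j <- r) F j z) x y = \sum_(j <- r) walk h d (F j) x y.
Proof.
elim: d y => //= k d IH y; rewrite !IH !mulr_sumr -big_split /=.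
by apply: eq_bigr.
Qed.

Lemma walk_shift h d f x y v : walk h d (fun z => f (z + v)) x y = walk h d f x (y + v).
Proof. by elim: d y => //= k d IH y; rewrite !IH addrAC. Qed.

Lemma walk_cat h d1 d2 f x y :
  walk h (d1 ++ d2) f x y = walk h d1 (fun z => walk h d2 f x z) x y.
Proof. by elim: d1 y => //= k d IH y; rewrite !IH. Qed.

(** The steps of the walk are independent translations, so two walks may be
    performed in either order. *)
Lemma walk_comm h d1 d2 f x y :
  walk h d1 (fun z => walk h d2 f x z) x y = walk h d2 (fun z => walk h d1 f x z) x y.
Proof.
elim: d1 y => //= k d IH y.
by rewrite walk_lin !IH (walk_shift h d2 (fun z => walk h d f x z)).
Qed.

Lemma walk_perm h d1 d2 f x y : perm_eq d1 d2 -> walk h d1 f x y = walk h d2 f x y.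
Proof.
move=> p.
apply: (@catCA_perm_ind _ (fun d => walk h d1 f x y = walk h d f x y) _ _ _ p) => // s1 s2 s3 ->.
rewrite !catA !(walk_cat h (_ ++ _)) !walk_cat.
exact: (walk_comm h s1 s2 (fun z => walk h s3 f x z)).
Qed.

Definition cube : set 'rV[R]_n :=
  [set x | forall k, a ord0 k <= x ord0 k <= a ord0 k + w].

Lemma bary_ge0_le1 k x : cube x -> 0 <= bary k x <= 1.
Proof.
move=> /(_ k) /andP[h1 h2]; rewrite /bary divr_ge0 ?subr_ge0 ?(ltW w_gt0)//=.
by rewrite ler_pdivrMr// mul1r lerBlDl.
Qed.

Lemma walk_le h d f g x y : cube x -> (forall z, f z <= g z) ->
  walk h d f x y <= walk h d g x y.
Proof.
move=> cx fg; elim: d y => //= k d IH y.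
have /andP[u0 u1] := bary_ge0_le1 k cx.
by rewrite lerD// ler_wpM2l// subr_ge0.
Qed.

Lemma walk_norm_le h d f g x y : cube x -> (forall z, `|f z| <= g z) ->
  `|walk h d f x y| <= walk h d g x y.
Proof.
move=> cx fg; rewrite ler_norml; apply/andP; split.
  rewrite (_ : - walk h d g x y = walk h d (fun z => -1 * g z + 0 * g z) x y); last first.
    by rewrite walk_lin; ring.
  by apply: walk_le => // z; have := fg z; rewrite ler_norml => /andP[+ _]; lra.
by apply: walk_le => // z; apply: le_trans (fg z); exact: ler_norm.
Qed.

(** The coordinate [k] of the end point is binomial: squared bias plus
    variance. *)
Lemma walk_sqr h d k (c : R) x y :
  walk h d (fun z => (z ord0 k - c) ^+ 2) x y =
  (y ord0 k + h * (count_mem k d)%:R * bary k x - c) ^+ 2 +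
    h ^+ 2 * (count_mem k d)%:R * (bary k x * (1 - bary k x)).
Proof.
elim: d y => [|j d IH] y /=; first by rewrite !mulr0 !mul0r !addr0.
rewrite !IH !mxE eqxx /= [in LHS]eq_sym.
have [->|jk] := eqVneq j k; first by rewrite /= natrD; ring.
by rewrite /= add0n; ring.
Qed.

Definition fdiff h i f z : R := (f (z + h *: e_ i) - f z) / h.

Lemma is_derive_bary i k x : is_derive x (e_ i) (bary k) ((i == k)%:R / w).
Proof.
have hc : is_derive x (e_ i) (fun z : 'rV[R]_n => z ord0 k) (i == k)%:R.
  by rewrite eq_sym; exact: is_derive_coord.
rewrite (_ : bary k = (w^-1 *: ((fun z : 'rV[R]_n => z ord0 k) - cst (a ord0 k)))).
  by apply: is_derive_eq; rewrite subr0 mulrC.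
by apply/funext => z; rewrite /bary mulrC.
Qed.

(** Increasing [bary i x] shifts mass from staying to moving in each of the
    [count_mem i d] steps along [i].  By independence these steps contribute
    equally, each with the mean increment of [f] along a walk that lacks the
    step. *)
Lemma is_derive_walk h d f i x y : h != 0 ->
  is_derive x (e_ i) (fun z => walk h d f z y)
    ((count_mem i d)%:R * h / w * walk h (rem i d) (fdiff h i f) x y).
Proof.
move=> h0; have w0 : w != 0 by rewrite gt_eqF.
have fdE d' x' y' : walk h d' (fdiff h i f) x' y' =
    (walk h d' f x' (y' + h *: e_ i) - walk h d' f x' y') / h.
  rewrite (_ : fdiff h i f = fun z => h^-1 * f (z + h *: e_ i) + (- h^-1) * f z).
    by rewrite walk_lin walk_shift; ring.
  by apply/funext => z; rewrite /fdiff; ring.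
elim: d y => [|k d IH] y /=.
  by rewrite !mul0r; exact: is_derive_cst.
have db := is_derive_bary i k x.
have h1 := IH y; have h2 := IH (y + h *: e_ k).
rewrite (_ : (fun z => _) = (cst 1 - bary k) * (fun z => walk h d f z y) +
   bary k * (fun z => walk h d f z (y + h *: e_ k))); last exact/funext.
have Z (p q : R) : p *: q = p * q by [].
apply: is_derive_eq; rewrite !Z ![in LHS]fctE.
have [ik|ik] := eqVneq k i.
  subst k; rewrite ?eqxx /=.
  have [id|id] := boolP (i \in d); last first.
    rewrite (count_memPn id) !fdE addn0.
    by field; rewrite h0 w0.
  rewrite (walk_perm h (fdiff h i f) x y (perm_to_rem id)) /= natrD !fdE.
  have E1 : walk h d f x y = (1 - bary i x) * walk h (rem i d) f x y + bary i x * walk h (rem i d) f x (y + h *: e_ i).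
    by rewrite (walk_perm h f x y (perm_to_rem id)).
  have E2 : walk h d f x (y + h *: e_ i) = (1 - bary i x) * walk h (rem i d) f x (y + h *: e_ i) + bary i x * walk h (rem i d) f x (y + h *: e_ i + h *: e_ i).
    by rewrite (walk_perm h f x _ (perm_to_rem id)).
  rewrite E1 E2.
  by field; rewrite h0 w0.
by rewrite /= add0n ?Z; ring.
Qed.

End walk.

(** * Uniform continuity and difference quotients *)

Section compact_support.
Context {R : realType}.

Lemma fsupport_out {T : topologicalType} (f : T -> R) x : ~ fsupport f x -> f x = 0.
Proof.
by move=> h; apply/eqP; apply: contra_notT h => fx; exact: subset_closure.
Qed.

Lemma fsupport_sub {T : topologicalType} (f : T -> R) (K : set T) :
  closed K -> (forall x, ~ K x -> f x = 0) -> fsupport f `<=` K.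
Proof.
move=> cK h; rewrite /fsupport closureE; apply: smallest_sub => // x /= fx.
by apply: contrapT => /h fx0; rewrite fx0 eqxx in fx.
Qed.

Lemma compact_norm_bounded {T : topologicalType} (f : T -> R) (K : set T) :
  continuous f -> compact K -> exists2 B, 0 <= B & forall x, K x -> `|f x| <= B.
Proof.
move=> cf cK.
have : compact (f @` K) by apply: continuous_compact => //; exact: continuous_subspaceT.
move=> /compact_bounded [M [Mr hM]]; exists (`|M| + 1); first by rewrite addr_ge0.
by move=> x Kx; apply: (hM _ _ (f x)); [rewrite (le_lt_trans (ler_norm M))// ltrDl|exists x].
Qed.

Lemma csupp_norm_bounded {T : topologicalType} (f : T -> R) :
  continuous f -> compact (fsupport f) -> exists2 B, 0 <= B & forall x, `|f x| <= B.
Proof.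
move=> cf cs; have [B B0 hB] := compact_norm_bounded cf cs; exists B => // x.
have [|/fsupport_out ->] := pselect (fsupport f x); first exact: hB.
by rewrite normr0.
Qed.

Lemma near_div_lt (A e : R) : 0 < e -> \forall m \near \oo, A / m%:R < e.
Proof.
move=> e0; near=> m.
have m0 : 0 < m%:R :> R by near: m; exact: nbhs_infty_gtr.
rewrite ltr_pdivrMr// mulrC -ltr_pdivrMr//.
by near: m; exact: nbhs_infty_gtr.
Unshelve. all: by end_near. Qed.

End compact_support.

Section euclid.
Context {R : realType} {n : nat}.
Implicit Types (f g : 'rV[R]_n -> R) (i k : 'I_n) (x y z v : 'rV[R]_n) (h : R).

Lemma rV_nbhsP x (A : set 'rV[R]_n) : nbhs x A <->
  exists2 e : R, 0 < e & forall y, (forall k, `|x ord0 k - y ord0 k| < e) -> A y.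
Proof.
split=> [/nbhs_ballP[e e0 h]|[e e0 h]].
  by exists e => // y hy; apply: h; split => // i k; rewrite ord1; exact: hy.
by apply/nbhs_ballP; exists e => //= y [_ hy]; apply: h => k; exact: hy.
Qed.

Lemma csupp_unif_cont g (e : R) : continuous g -> compact (fsupport g) -> 0 < e ->
  exists2 d : R, 0 < d & forall x y, (forall k, `|x ord0 k - y ord0 k| < d) ->
    `|g x - g y| <= e.
Proof.
move=> cg cs e0.
(* The support is covered uniformly; [y] ranges over the whole space. *)
pose P (d : R) x := forall y, (forall k, `|x ord0 k - y ord0 k| < d) -> `|g x - g y| <= e.
have : \forall d \near (0 : R)^'+, fsupport g `<=` P d.
  apply: ((compact_near_coveringP _).1 cs) => x _.
  have /cvgrPdist_lt/(_ (e / 2)) := cg x.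
  rewrite divr_gt0// => /(_ isT) /rV_nbhsP [r r0 hr].
  have hx : nbhs x [set x' : 'rV[R]_n | forall k, `|x ord0 k - x' ord0 k| < r / 2].
    by apply/rV_nbhsP; exists (r / 2) => //; rewrite divr_gt0.
  have hd : \forall d \near (0 : R)^'+, d < r / 2.
    by apply: nbhs_right_lt; rewrite divr_gt0.
  near=> x' d => y hy.
  have xx' : forall k, `|x ord0 k - x' ord0 k| < r / 2 by near: x'; exact: hx.
  have dr : d < r / 2 by near: d.
  have h1 : `|g x - g x'| < e / 2.
    by apply: hr => k; rewrite (lt_trans (xx' k))// ltr_pdivrMr// ltr_pMr// ltr1n.
  have h2 : `|g x - g y| < e / 2.
    apply: hr => k; rewrite (splitr r) -(subrK (x' ord0 k) (x ord0 k)) -addrA.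
    rewrite (le_lt_trans (ler_normD _ _))// ltrD//.
    exact: lt_trans (hy k) dr.
  rewrite -(subrK (g x) (g x')) -addrA (le_trans (ler_normD _ _))//.
  by rewrite (splitr e) lerD// ?(distrC (g x')) ltW.
move=> h.
have [d [/= d0 hd]] : exists d : R, 0 < d /\ fsupport g `<=` P d.
  have h0 : \forall d \near (0 : R)^'+, 0 < d by exact: nbhs_right_gt.
  by have [d [? ?]] := filter_ex (filterI h0 h); exists d.
exists d => // x y xy.
have [sx|/fsupport_out gx] := pselect (fsupport g x); first exact: hd.
have [sy|/fsupport_out gy] := pselect (fsupport g y); last by rewrite gx gy subrr normr0 ltW.
by rewrite distrC; apply: (hd _ sy) => k; rewrite distrC.
Unshelve. all: by end_near. Qed.

(** Uniform continuity in a form that a positive operator can average: the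
    increments are dominated by a small constant plus a quadratic function,
    whose mean along a random walk is a variance. *)
Lemma csupp_quad_modulus g (e : R) : continuous g -> compact (fsupport g) -> 0 < e ->
  exists2 C : R, 0 <= C & forall x y,
    `|g y - g x| <= e + C * \sum_(k < n) (y ord0 k - x ord0 k) ^+ 2.
Proof.
move=> cg cs e0.
have [d d0 hd] := csupp_unif_cont cg cs e0.
have [B B0 hB] := csupp_norm_bounded cg cs.
have d20 : 0 < d ^+ 2 by rewrite exprn_gt0.
have C0 : 0 <= 2 * B / d ^+ 2 by apply: divr_ge0; [exact: mulr_ge0|exact: ltW].
exists (2 * B / d ^+ 2) => //.
move=> x y.
have sum0 (Q : pred 'I_n) : 0 <= \sum_(k < n | Q k) (y ord0 k - x ord0 k) ^+ 2.
  by apply: sumr_ge0 => k _; exact: sqr_ge0.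
have [hc|/existsNP[k /negP]] := pselect (forall k, `|y ord0 k - x ord0 k| < d).
  by rewrite (le_trans (hd _ _ hc))// lerDl mulr_ge0 ?sum0.
rewrite -leNgt => dk.
have : d ^+ 2 <= \sum_(k < n) (y ord0 k - x ord0 k) ^+ 2.
  rewrite (bigD1 k)//= -(real_normK (num_real (y ord0 k - x ord0 k))).
  by rewrite ler_wpDr ?sum0// lerXn2r// nnegrE ltW.
move=> hs; rewrite ler_wpDl ?(ltW e0)//.
apply: (@le_trans _ _ (2 * B)).
  by rewrite mulr_natl mulr2n (le_trans (ler_normB _ _))// lerD.
rewrite -[leLHS]mulr1 -[leRHS]mulrA ler_wpM2l ?mulr_ge0//.
by rewrite mulrC ler_pdivlMr// mul1r.
Qed.

Lemma derive_shift_arg f v z (u : 'rV[R]_n) :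
  'D_u (fun y => f (y + v)) z = 'D_u f (z + v).
Proof.
rewrite /derive; set g1 := fun h => h^-1 *: _; set g2 := fun h => h^-1 *: _.
suff -> : g1 = g2 by [].
by rewrite funeqE /g1 /g2 => h /=; rewrite addrA.
Qed.

Lemma derivable_shift_arg f v z (u : 'rV[R]_n) :
  derivable f (z + v) u -> derivable (fun y => f (y + v)) z u.
Proof.
rewrite /derivable; set g1 := fun h => h^-1 *: _; set g2 := fun h => h^-1 *: _.
suff -> : g1 = g2 by [].
by rewrite funeqE /g1 /g2 => h /=; rewrite addrA.
Qed.

Lemma smooth_shift f v : smooth_on setT f -> smooth_on setT (fun y => f (y + v)).
Proof.
move=> sf s x _.
have E t : iter_partial t (fun y => f (y + v)) = fun y => iter_partial t f (y + v).
  elim: t => //= j t ->; apply/funext => y; exact: derive_shift_arg.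
rewrite E; have [cf df] := sf s (x + v) I; split.
  apply: (@continuous_comp _ _ _ (fun y => y + v)); last exact: cf.
  by apply: continuousD; [exact: cvg_id|exact: cst_continuous].
by move=> j; exact: derivable_shift_arg.
Qed.

Lemma smooth_fdiff h i f : smooth_on setT f -> smooth_on setT (fdiff h i f).
Proof.
move=> sf; rewrite /fdiff.
apply: (@smooth_on_mul _ _ _ _ (fun=> h^-1)); [exact: openT| |exact: smooth_on_cst].
apply: smooth_on_add; [exact: openT|exact: smooth_shift|].
apply: (smooth_on_ext openT _ (smooth_on_mul openT (@smooth_on_cst _ _ setT (-1)) sf)).
by move=> y _; rewrite mulN1r.
Qed.

Lemma partial_fdiff h i j f : smooth_on setT f ->
  'D_(e_ j) (fdiff h i f) = fdiff h i ('D_(e_ j) f).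
Proof.
move=> sf; apply/funext => z.
have d1 : is_derive z (e_ j) (fun y => f (y + h *: e_ i)) ('D_(e_ j) f (z + h *: e_ i)).
  apply: DeriveDef; last exact: derive_shift_arg.
  by apply: derivable_shift_arg; exact: smooth_on_derivable sf I.
have d2 : is_derive z (e_ j) f ('D_(e_ j) f z).
  by apply: derivableP; exact: smooth_on_derivable sf I.
rewrite (_ : fdiff h i f = h^-1 *: ((fun y => f (y + h *: e_ i)) - f)).
  by rewrite derive_val /fdiff mulrC.
by apply/funext => y; rewrite /fdiff mulrC.
Qed.

Lemma iter_partial_fdiff h i s f : smooth_on setT f ->
  iter_partial s (fdiff h i f) = fdiff h i (iter_partial s f).
Proof.
move=> sf; elim: s => //= j s ->; apply: partial_fdiff.
exact: smooth_on_iter.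
Qed.

Definition fdiffs h (s : seq 'I_n) f := foldr (fdiff h) f s.

Lemma fdiffC h i j f : fdiff h i (fdiff h j f) = fdiff h j (fdiff h i f).
Proof.
apply/funext => z; rewrite /fdiff (addrAC z); ring.
Qed.

Lemma fdiffs_fdiff h i s f : fdiff h i (fdiffs h s f) = fdiffs h s (fdiff h i f).
Proof. by elim: s => //= j s IH; rewrite fdiffC IH. Qed.

Lemma fdiff_MVT h i f z : 0 < h -> smooth_on setT f ->
  exists2 t, 0 <= t <= h & fdiff h i f z = 'D_(e_ i) f (z + t *: e_ i).
Proof.
move=> h0 sf.
pose p (t : R) := f (z + t *: e_ i).
have dp (t : R) : is_derive t (1 : R) p ('D_(e_ i) f (z + t *: e_ i)).
  have df : derivable f (z + t *: e_ i) (e_ i) by exact: smooth_on_derivable sf I.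
  have E : (fun u : R => p (u + t)) = fun u : R => f (u *: e_ i + (z + t *: e_ i)).
    by apply/funext => u; rewrite /p scalerDl addrCA.
  split.
    apply/derivable1P => /=.
    rewrite (_ : (fun u : R => _) = fun u : R => f (u *: e_ i + (z + t *: e_ i))).
      exact/(derivable1P f (z + t *: e_ i) (e_ i)).1.
    by rewrite -E; apply/funext => u; rewrite [_%:A]mulr1.
  rewrite /derive; set g1 := fun u => u^-1 *: _; set g2 := fun u => u^-1 *: _.
  suff -> : g1 = g2 by [].
  rewrite funeqE /g1 /g2 => u /=; rewrite [_%:A]mulr1.
  by have /= -> := congr1 (@^~ u) E.
have cp : {within `[0, h], continuous p}.
  apply: continuous_subspaceT => t; apply: differentiable_continuous.
  by apply/derivable1_diffP; have [] := dp t.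
have [t] := MVT_segment (ltW h0) (fun t _ => dp t) cp.
rewrite in_itv /= => t0 E; exists t => //.
rewrite /fdiff (_ : f (z + h *: _) - f z = p h - p 0).
  by rewrite E subr0 mulfK// gt_eqF.
by rewrite /p scale0r addr0.
Qed.

(** Difference quotients commute with one another and with partial derivatives.
    Hence the outermost quotient can be taken innermost, where the induction
    hypothesis applies to it, and then comes out as a quotient of
    [iter_partial s f], to which the mean value theorem applies. *)
Lemma fdiffs_MVT h s f z : 0 < h -> smooth_on setT f ->
  exists2 v : 'rV[R]_n, (forall k, `|v ord0 k| <= (size s)%:R * h) &
    fdiffs h s f z = iter_partial s f (z + v).
Proof.
move=> h0; elim: s f => [|i s IH] f sf.
  by exists 0; [move=> k; rewrite mxE normr0 mul0r|rewrite addr0].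
have [v hv] := IH _ (smooth_fdiff h i sf).
rewrite /= fdiffs_fdiff => ->; rewrite iter_partial_fdiff//.
have [t /andP[t0 th] ->] := fdiff_MVT i (z + v) h0 (smooth_on_iter s sf).
exists (v + t *: e_ i); last by rewrite addrA.
move=> k; rewrite !mxE eqxx /= (le_trans (ler_normD _ _))//.
rewrite -natr1 mulrDl mul1r lerD// normrM (ger0_norm t0).
by case: (k == i); rewrite ?normr1 ?mulr1// normr0 mulr0 ltW.
Qed.

Lemma fsupport_iter_partial s f : fsupport (iter_partial s f) `<=` fsupport f.
Proof.
apply: fsupport_sub; first exact: closed_closure.
move=> x hx.
have oU : open (~` fsupport f) by apply: closed_openC; exact: closed_closure.
rewrite (@eq_on_iter _ _ _ _ (fun=> 0) s oU) //; last by move=> y /fsupport_out.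
elim: s {hx} x => //= i s IH x.
rewrite (_ : iter_partial s (fun=> 0) = cst 0); last exact/funext.
exact: derive_cst.
Qed.

Lemma compact_fsupport_iter s f : compact (fsupport f) -> compact (fsupport (iter_partial s f)).
Proof.
move=> cf; apply: subclosed_compact cf (@fsupport_iter_partial s f).
exact: closed_closure.
Qed.

End euclid.

(** * Bernstein operators converge with all derivatives *)

Section bernstein.
Context {R : realType} {n : nat}.
Variables (a : 'rV[R]_n) (w : R).
Hypothesis w_gt0 : 0 < w.
Implicit Types (f g : 'rV[R]_n -> R) (i k : 'I_n) (x y z : 'rV[R]_n) (h : R).

Definition rems (s d : seq 'I_n) : seq 'I_n := foldr (fun i => rem i) d s.

(** The product of the factors [count * h / w] that [is_derive_walk] produces
    when one differentiates successively along the directions in [s], the walk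
    becoming shorter each time. *)
Fixpoint walk_coef h (d s : seq 'I_n) : R :=
  if s is i :: s' then walk_coef h d s' * ((count_mem i (rems s' d))%:R * h / w)
  else 1.

Lemma iter_partial_walk h d s f y : h != 0 ->
  iter_partial s (fun x => walk a w h d f x y) =
  fun x => walk_coef h d s * walk a w h (rems s d) (fdiffs h s f) x y.
Proof.
move=> h0; elim: s => [|i s IH] /=; first by apply/funext => x; rewrite mul1r.
rewrite IH; apply/funext => x.
have D := is_derive_walk a w_gt0 (rems s d) (fdiffs h s f) i x y h0.
have [_] := is_deriveZ (walk_coef h d s) D.
by move=> E; rewrite -[RHS]mulrA; exact: E.
Qed.

Lemma count_rems k s d : count_mem k (rems s d) = (count_mem k d - count_mem k s)%N.
Proof. by elim: s => [|i s IH] /=; rewrite ?subn0// count_mem_rem IH subnDA subnAC. Qed.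

Definition all_dirs m : seq 'I_n := flatten [seq nseq m k | k <- enum 'I_n].

Lemma count_all_dirs k m : count_mem k (all_dirs m) = m.
Proof.
rewrite count_flatten -map_comp sumnE big_map big_enum /= (bigD1 k)//=.
rewrite count_nseq /= eqxx mul1n big1 ?addn0// => j jk.
by rewrite count_nseq /= (negbTE jk).
Qed.

Definition bernstein m f x : R := walk a w (w / m%:R) (all_dirs m) f x a.

(** Each factor is [(m - r) / m], or 0 if [m < r], with [r] at most the number of
    derivatives taken, so that the product is [1 - O(1 / m)]. *)
Lemma walk_coef_bound m s : (0 < m)%N ->
  0 <= walk_coef (w / m%:R) (all_dirs m) s <= 1 /\
  1 - walk_coef (w / m%:R) (all_dirs m) s <= (size s)%:R * (size s)%:R / m%:R.
Proof.
move=> m0.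
have mR : 0 < m%:R :> R by rewrite ltr0n.
(* For the induction on [s], the bound on each factor is fixed beforehand. *)
suff H S : (size s <= S)%N -> 0 <= walk_coef (w / m%:R) (all_dirs m) s <= 1 /\
  1 - walk_coef (w / m%:R) (all_dirs m) s <= (size s)%:R * S%:R / m%:R by exact: H.
elim: s => [|i s IH] /= sS; first by rewrite ler01 lexx subrr !mul0r.
have [/andP[c0 c1] c2] := IH (ltnW sS).
set c := walk_coef _ _ s in c0 c1 c2 *.
rewrite count_rems count_all_dirs.
set N := (m - _)%N.
have -> : N%:R * (w / m%:R) / w = N%:R / m%:R :> R by field; rewrite !gt_eqF.
have q0 : 0 <= N%:R / m%:R :> R by rewrite divr_ge0.
have q1 : N%:R / m%:R <= 1 :> R by rewrite ler_pdivrMr// mul1r ler_nat leq_subr.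
have q2 : 1 - N%:R / m%:R <= S%:R / m%:R :> R.
  rewrite lerBlDr -mulrDl ler_pdivlMr// mul1r -natrD ler_nat.
  rewrite -leq_subLR; apply: leq_sub2l.
  by rewrite (leq_trans (count_size _ _))// ltnW.
split; first by rewrite mulr_ge0//= mulr_ile1.
rewrite -natr1 !mulrDl mul1r.
have -> : 1 - c * (N%:R / m%:R) = (1 - c) + c * (1 - N%:R / m%:R) by ring.
rewrite lerD// (le_trans _ q2)// ler_piMl// subr_ge0//.
Qed.

(** Removing the [size s] steps used up by differentiation moves the mean of
    each coordinate by at most [w * size s / m] away from [x]; the binomial
    variance is at most [w ^ 2 / m]. *)
Lemma walk_variance m s x : (0 < m)%N -> cube a w x ->
  walk a w (w / m%:R) (rems s (all_dirs m))
    (fun z => \sum_(k < n) (z ord0 k - x ord0 k) ^+ 2) x a <=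
  n%:R * (w ^+ 2 * ((size s)%:R ^+ 2 + 1)) / m%:R.
Proof.
move=> m0 cx.
have mR : 0 < m%:R :> R by rewrite ltr0n.
rewrite walk_sum.
have H k : walk a w (w / m%:R) (rems s (all_dirs m))
    (fun z => (z ord0 k - x ord0 k) ^+ 2) x a <= w ^+ 2 * ((size s)%:R ^+ 2 + 1) / m%:R.
  rewrite walk_sqr count_rems count_all_dirs.
  have /andP[u0 u1] := bary_ge0_le1 w_gt0 k cx.
  set u := bary _ _ _ _ in u0 u1 *.
  have -> : x ord0 k = a ord0 k + w * u by rewrite /u /bary; field; rewrite gt_eqF.
  set N := (m - _)%N.
  have Nm : N%:R <= m%:R :> R by rewrite ler_nat leq_subr.
  have mN : m%:R - N%:R <= (size s)%:R :> R.
    rewrite lerBlDr -natrD ler_nat -leq_subLR leq_sub2l//.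
    exact: count_size.
  have m1 : 1 <= m%:R :> R by rewrite ler1n.
  clearbody u N.
  have -> : (a ord0 k + w / m%:R * N%:R * u - (a ord0 k + w * u)) ^+ 2 +
     (w / m%:R) ^+ 2 * N%:R * (u * (1 - u)) =
     w ^+ 2 * ((u * (m%:R - N%:R)) ^+ 2 / m%:R + N%:R / m%:R * (u * (1 - u))) / m%:R.
    by field; rewrite gt_eqF.
  rewrite ler_wpM2r ?invr_ge0 ?ler0n// ler_wpM2l ?sqr_ge0// lerD//.
    rewrite ler_pdivrMr// (@le_trans _ _ ((size s)%:R ^+ 2))//; last first.
      by rewrite ler_peMr ?sqr_ge0.
    rewrite lerXn2r ?nnegrE ?mulr_ge0 ?subr_ge0//.
    by rewrite (le_trans _ mN)// ler_piMl// subr_ge0.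
  rewrite mulr_ile1 ?divr_ge0 ?mulr_ge0 ?subr_ge0//.
    by rewrite ler_pdivrMr// mul1r.
  by rewrite mulr_ile1 ?subr_ge0// gerBl.
apply: (@le_trans _ _ (\sum_(k < n) (w ^+ 2 * ((size s)%:R ^+ 2 + 1) / m%:R))).
  by apply: ler_sum => k _; exact: H.
by rewrite sumr_const card_ord -[leLHS]mulr_natl mulrA.
Qed.

(** A derivative of the Bernstein polynomial is a coefficient close to 1 times
    the mean of an iterated difference quotient of [f], which is the
    corresponding derivative of [f] at a point close to the end of the walk;
    and the walk ends close to [x] on average. *)
Theorem bernstein_cvg f s (e : R) : smooth_on setT f -> compact (fsupport f) -> 0 < e ->
  \forall m \near \oo, forall x, cube a w x ->
    `|iter_partial s (bernstein m f) x - iter_partial s f x| <= e.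
Proof.
move=> sf cf e0.
set g := iter_partial s f.
have cg : continuous g by move=> x; exact: smooth_on_continuous (smooth_on_iter s sf) I.
have cgs : compact (fsupport g) by exact: compact_fsupport_iter.
have e4 : 0 < e / 4 by rewrite divr_gt0.
have [d d0 hd] := csupp_unif_cont cg cgs e4.
have [C C0 hC] := csupp_quad_modulus cg cgs e4.
have [B B0 hB] := csupp_norm_bounded cg cgs.
near=> m.
have m0 : (0 < m)%N by near: m; exact: nbhs_infty_gt.
have mR : 0 < m%:R :> R by rewrite ltr0n.
have b1 : (size s)%:R * (size s)%:R * B / m%:R < e / 4 by near: m; exact: near_div_lt.
have b2 : C * (n%:R * (w ^+ 2 * ((size s)%:R ^+ 2 + 1))) / m%:R < e / 4.
  by near: m; exact: near_div_lt.
have b3 : (size s)%:R * w / m%:R < d by near: m; exact: near_div_lt.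
move=> x cx.
set h := w / m%:R.
have h0 : 0 < h by rewrite divr_gt0.
rewrite /bernstein iter_partial_walk ?gt_eqF//.
have [/andP[c0 c1] c2] := walk_coef_bound s m0.
set c := walk_coef _ _ _ in c0 c1 c2 *.
set W := walk _ _ _ _ _ _ _.
have WB : `|W| <= B.
  rewrite -(walk_cst a w h (rems s (all_dirs m)) B x a).
  apply: walk_norm_le => // z.
  by have [v _ ->] := fdiffs_MVT s z h0 sf; exact: hB.
have Wg : `|W - g x| <= e / 2 + C * (n%:R * (w ^+ 2 * ((size s)%:R ^+ 2 + 1)) / m%:R).
  have -> : W - g x = walk a w h (rems s (all_dirs m)) (fun z => 1 * fdiffs h s f z + (-1) * g x) x a.
    by rewrite (walk_lin a w h _ 1 (-1) (fdiffs h s f) (fun=> g x)) walk_cst mul1r mulN1r.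
  pose q z := \sum_(k < n) (z ord0 k - x ord0 k) ^+ 2.
  apply: (@le_trans _ _ (walk a w h (rems s (all_dirs m)) (fun z => (e / 2) * 1 + C * q z) x a)).
    apply: walk_norm_le => // z.
    have [v hv ->] := fdiffs_MVT s z h0 sf.
    rewrite -/g mul1r mulN1r -(subrK (g z) (g (z + v))) -addrA mulr1 {1}(_ : e / 2 = e / 4 + e / 4); last by lra.
    rewrite (le_trans (ler_normD _ _))// -addrA lerD//.
    apply: hd => k; rewrite mxE addrAC subrr add0r (le_lt_trans (hv k))//.
    by rewrite /h mulrA.
  rewrite (walk_lin a w h _ (e / 2) C (fun=> 1) q) walk_cst mulr1 lerD2l ler_wpM2l//.
  exact: walk_variance.
(* [b1], [b2], [b3] bound, in this order, the effect of [c] not being 1, of the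
   variance, and of the displacement given by the mean value theorem. *)
have -> : c * W - g x = (W - g x) - (1 - c) * W by ring.
rewrite (le_trans (ler_normB _ _))// normrM (ger0_norm (_ : 0 <= 1 - c)) ?subr_ge0//.
have : (1 - c) * `|W| <= (size s)%:R * (size s)%:R * B / m%:R.
  by rewrite (mulrAC _ B) ler_pM// subr_ge0.
move: Wg b2; rewrite mulrA.
lra.
Unshelve. all: by end_near. Qed.

(** Weights, as functions of [x], and end points of all the paths of the walk:
    they show that a Bernstein polynomial depends on [f] only through finitely
    many values. *)
Fixpoint walk_pts h (d : seq 'I_n) y : seq (('rV[R]_n -> R) * 'rV[R]_n) :=
  if d is k :: d' then
    [seq ((fun x => (1 - bary a w k x) * p.1 x), p.2) | p <- walk_pts h d' y] ++
    [seq ((fun x => bary a w k x * p.1 x), p.2) | p <- walk_pts h d' (y + h *: e_ k)]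
  else [:: ((fun=> 1), y)].

Lemma walkE h d f x y : walk a w h d f x y = \sum_(p <- walk_pts h d y) p.1 x * f p.2.
Proof.
elim: d y => [|k d IH] y /=; first by rewrite big_seq1 mul1r.
rewrite big_cat !big_map /= !IH !mulr_sumr.
by congr (_ + _); apply: eq_bigr => p _; rewrite mulrA.
Qed.

Lemma smooth_bary k : smooth_on setT (bary a w k).
Proof.
apply: (@smooth_on_mul _ _ _ _ (fun=> w^-1)); [exact: openT| |exact: smooth_on_cst].
apply: smooth_on_add; [exact: openT|exact/smooth_on_coord/openT|exact: smooth_on_cst].
Qed.

Lemma smooth_walk_pts h d y j : smooth_on setT (nth ((fun=> 0), 0) (walk_pts h d y) j).1.
Proof.
elim: d y j => [|k d IH] y j /=.
  by case: j => [|j] /=; rewrite ?nth_nil; exact: smooth_on_cst.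
rewrite nth_cat size_map; case: ltnP => jl.
  rewrite (nth_map ((fun=> 0), 0))//=; apply: smooth_on_mul => //; first exact: openT.
  have s1 := @smooth_on_mul _ _ _ _ (fun=> -1) openT (smooth_bary k) (@smooth_on_cst _ _ _ (-1)).
  apply: (smooth_on_ext openT _ (smooth_on_add openT (@smooth_on_cst _ _ _ 1) s1)).
  by move=> z _; rewrite mulrN1.
have [jl2|jl2] := ltnP (j - size (walk_pts h d y)) (size (walk_pts h d (y + h *: e_ k))).
  rewrite (nth_map ((fun=> 0), 0))//=; apply: smooth_on_mul => //; first exact: openT.
  exact: smooth_bary.
by rewrite nth_default ?size_map//=; exact: smooth_on_cst.
Qed.

Definition bernstein_weight m j := (nth ((fun=> 0), 0) (walk_pts (w / m%:R) (all_dirs m) a) j).1.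
Definition bernstein_node m j : 'rV[R]_n := (nth ((fun=> 0), 0) (walk_pts (w / m%:R) (all_dirs m) a) j).2.
Definition bernstein_size m := size (walk_pts (w / m%:R) (all_dirs m) a).

Lemma bernsteinE m f x : bernstein m f x =
  \sum_(j < bernstein_size m) bernstein_weight m j x * f (bernstein_node m j).
Proof. by rewrite /bernstein walkE (big_nth ((fun=> 0), 0)) big_mkord. Qed.

Lemma smooth_bernstein_weight m j : smooth_on setT (bernstein_weight m j).
Proof. exact: smooth_walk_pts. Qed.

End bernstein.

(** * A univariate cutoff *)

Section flat.
Context {R : realType}.
Implicit Types (p : {poly R}) (x y h : R).

(** Functions [p(1 / x) exp(- 1 / x)], extended by 0 to [x <= 0], for all
    polynomials [p] at once: this family is stable under differentiation. *)
Definition flat p x : R := if 0 < x then p.[x^-1] * expR (- x^-1) else 0.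

Lemma expRN_le (y : R) m : 0 < y -> expR (- y) <= (m.+1)`!%:R / y ^+ m.+1.
Proof.
move=> y0; rewrite expRN -[leRHS]invf_div lef_pV2 ?posrE ?expR_gt0//.
  by apply: le_trans (expR_ge1Dxn m (ltW y0)); rewrite lerDr.
by rewrite divr_gt0 ?exprn_gt0// ltr0n fact_gt0.
Qed.

Lemma horner_norm_le p y : 1 <= y -> `|p.[y]| <= (\sum_(i < size p) `|p`_i|) * y ^+ size p.
Proof.
move=> y1; rewrite horner_coef mulr_suml (le_trans (ler_norm_sum _ _ _))//.
apply: ler_sum => i _; rewrite normrM ler_wpM2l//.
by rewrite normrX (ger0_norm (le_trans ler01 y1)) ler_weXn2l// ltnW.
Qed.

(** The exponential series bounds [exp(- y)] by a multiple of any negative power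
    of [y = 1 / h]; two powers more than the degree of [p] leave [h ^ 2]. *)
Lemma flat_le p : exists C, forall h, h < 1 -> `|flat p h| <= C * h ^+ 2.
Proof.
pose S := \sum_(i < size p) `|p`_i|.
have S0 : 0 <= S by apply: sumr_ge0.
exists (S * ((size p).+2)`!%:R) => h h1; rewrite /flat.
case: ifPn => [h0|_]; last by rewrite normr0 mulr_ge0 ?sqr_ge0// mulr_ge0.
have y1 : 1 <= h^-1 by rewrite invf_ge1// ltW.
have y0 : 0 < h^-1 by rewrite invr_gt0.
rewrite normrM (ger0_norm (expR_ge0 _)).
apply: (le_trans (ler_pM _ (expR_ge0 _) (horner_norm_le p y1) (expRN_le (size p).+1 y0))) => //.
rewrite -/S le_eqVlt; apply/orP; left; apply/eqP.
rewrite !exprS exprVn; set t := h ^+ size p.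
have t0 : t != 0 by rewrite gt_eqF// exprn_gt0.
by rewrite expr0; field; rewrite t0 gt_eqF.
Qed.

Lemma is_derive_quad (F : R -> R) (C : R) : F 0 = 0 ->
  (forall h, h < 1 -> `|F h| <= C * h ^+ 2) -> is_derive (0 : R) (1 : R) F 0.
Proof.
move=> F0 hF.
have : (fun h => h^-1 *: (F (h *: 1 + 0) - F 0)) @ 0^' --> (0 : R).
  apply/cvgr0Pnorm_le => e e0; near=> h.
  have h0 : h != 0 by near: h; exact: nbhs_dnbhs_neq.
  have h1 : `|h| < 1 by near: h; apply: dnbhs0_lt.
  have h2 : `|h| < e / (`|C| + 1) by near: h; apply: dnbhs0_lt; rewrite divr_gt0// ltr_wpDl.
  rewrite F0 subr0 addr0 [_%:A]mulr1 -[_ *: _]/(_ * _) normrM normfV.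
  rewrite ler_pdivrMl ?normr_gt0// (le_trans (hF _ _)) ?(le_lt_trans (ler_norm h))//.
  rewrite -(real_normK (num_real h)) expr2 mulrCA ler_wpM2l//.
  rewrite ltr_pdivlMr ?ltr_wpDl// in h2; move: (ler_norm C) (normr_ge0 h) => hC hh.
  rewrite (le_trans _ (ltW h2))// mulrC ler_wpM2l//.
  by rewrite (le_trans hC)// lerDl.
by move=> cF; split; [apply/cvg_ex; exists 0|exact: cvg_lim cF].
Unshelve. all: by end_near. Qed.

(** At 0, the quadratic bound makes the difference quotients tend to 0. *)
Lemma is_derive_flat p x : is_derive x (1 : R) (flat p) (flat ('X^2 * (p - p^`())) x).
Proof.
have [x0|x0|<-] := ltgtP 0 x.
- have D : is_derive x (1 : R) (fun z : R => p.[z^-1] * expR (- z^-1)) (flat ('X^2 * (p - p^`())) x).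
    have x1 : x != 0 by rewrite gt_eqF.
    have d1 : is_derive x (1 : R) (fun z : R => z^-1) (- x ^- 2).
      have := is_deriveV (f := id) x1 (is_derive_id x (1 : R)).
      by rewrite /= [_ *: _]mulr1.
    have d2 := is_derive1_comp (is_derive_poly p x^-1) d1.
    have d3 : is_derive x (1 : R) (fun z : R => expR (- z^-1)) (expR (- x^-1) * - - x ^- 2).
exact: (@is_derive1_comp _ expR (fun z : R => - z^-1) _ _ _ (is_derive_expR (- x^-1)) (is_deriveN d1)).
    apply: (is_derive_eq (is_deriveM d2 d3)).
    rewrite /flat x0 !hornerE /= -![_ *: _]/(_ * _).
    by rewrite exprVn; ring.
  apply: near_eq_is_derive D; near=> z; rewrite /flat ifT//.
  by near: z; exact: lt_nbhsr.
- have D : is_derive x (1 : R) (fun=> 0 : R) (0 : R) by exact: is_derive_cst.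
  rewrite /flat lt_gtF//; apply: near_eq_is_derive D; near=> z; rewrite ifF//.
  by apply/negbTE; rewrite -leNgt ltW//; near: z; exact: lt_nbhsl.
- rewrite {2}/flat ltxx; have [C hC] := flat_le p.
  by apply: is_derive_quad hC; rewrite /flat ltxx.
Unshelve. all: by end_near. Qed.

Definition psi : R -> R := flat 1.

Lemma smooth1_psi : smooth1 psi.
Proof.
exists (fun k => flat (iter k (fun p => 'X^2 * (p - p^`())) 1)) => // k x.
exact: is_derive_flat.
Qed.

Lemma psi_eq0 x : x <= 0 -> psi x = 0.
Proof. by rewrite /psi /flat => /le_gtF ->. Qed.

Lemma psi_gt0 x : 0 < x -> 0 < psi x.
Proof. by rewrite /psi /flat => ->; rewrite hornerE ?mul1r expR_gt0. Qed.

Lemma psi_le x y : 0 < x -> x <= y -> psi x <= psi y.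
Proof.
move=> x0 xy; have y0 := lt_le_trans x0 xy.
by rewrite /psi /flat x0 y0 !hornerE ?mul1r ler_expR lerN2 lef_pV2.
Qed.

(** As [psi] vanishes exactly on the nonpositive numbers and is increasing on
    the others, the inner [psi] is 0 for [t <= 1], which makes the outer one
    constant, and it is at least [psi 1] for [t >= 2], which makes the outer one
    vanish. *)
Definition bump (t : R) : R := psi (psi 1 - psi (t - 1)) / psi (psi 1).

Lemma bump1 t : t <= 1 -> bump t = 1.
Proof.
move=> t1; rewrite /bump (@psi_eq0 (t - 1)) ?subr_le0// subr0 divff// gt_eqF//.
exact/psi_gt0/psi_gt0.
Qed.

Lemma bump0 t : 2 <= t -> bump t = 0.
Proof.
move=> t2; rewrite /bump psi_eq0 ?mul0r// subr_le0 psi_le//.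
by rewrite lerBrDr.
Qed.

Lemma smooth_on_bump n (U : set 'rV[R]_n) f : open U -> smooth_on U f ->
  smooth_on U (fun v => bump (f v)).
Proof.
move=> oU sf; apply: (@smooth_on_mul _ _ _ _ (fun=> _)); [exact: oU| |exact: smooth_on_cst].
apply: (smooth_on_comp oU smooth1_psi).
apply: smooth_on_add; [exact: oU|exact: smooth_on_cst|].
have h : smooth_on U (fun v => psi (f v - 1)).
  apply: (smooth_on_comp oU smooth1_psi).
  by apply: smooth_on_add; [exact: oU|exact: sf|exact: smooth_on_cst].
apply: (smooth_on_ext oU _ (smooth_on_mul oU (@smooth_on_cst _ _ _ (-1)) h)).
by move=> v _; rewrite mulN1r.
Qed.

End flat.

(** * Distributions on open sets as limits of point masses *)

Section linear_functionals.
Context {R : realType} {T : Type}.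

Lemma linear_on_sum (D : set (T -> R)) (L : (T -> R) -> R) (I : Type) (r : seq I)
    (c : I -> R) (g : I -> T -> R) : linear_on D L ->
  D (fun=> 0) -> (forall (b : R) f h, D f -> D h -> D (fun x => b * f x + h x)) ->
  (forall i, D (g i)) ->
  L (fun x => \sum_(i <- r) c i * g i x) = \sum_(i <- r) c i * L (g i).
Proof.
move=> lL D0 DD Dg.
have L0 : L (fun=> 0) = 0.
  have := lL 1 _ _ D0 D0; rewrite [X in L X = _](_ : _ = fun=> 0); first by lra.
  by apply/funext => x; rewrite mulr0 addr0.
suff [//] : L (fun x => \sum_(i <- r) c i * g i x) = \sum_(i <- r) c i * L (g i) /\
  D (fun x => \sum_(i <- r) c i * g i x).
elim: r => [|i r [IH1 IH2]].
  rewrite big_nil (_ : (fun x => _) = fun=> 0) //.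
  by apply/funext => x; rewrite big_nil.
rewrite big_cons -IH1 -lL//.
rewrite (_ : (fun x => _) = fun x => c i * g i x + \sum_(j <- r) c j * g j x).
  by split=> //; exact: DD.
by apply/funext => x; rewrite big_cons.
Qed.

End linear_functionals.

Section euclid.
Context {R : realType} {n : nat}.
Implicit Types (f g : 'rV[R]_n -> R) (i k : 'I_n) (x y z v : 'rV[R]_n) (h : R).

Lemma eucl_testI (V K : set 'rV[R]_n) f : smooth_on setT f -> compact K -> K `<=` V ->
  (forall x, ~ K x -> f x = 0) -> eucl_test_function V f.
Proof.
move=> sf cK KV f0.
have clK : closed K by apply: compact_closed => //; exact: norm_hausdorff.
have sK := fsupport_sub clK f0.
split=> //; last exact: subset_trans KV.
by apply: subclosed_compact cK sK; exact: closed_closure.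
Qed.

Lemma eucl_test_lin (V : set 'rV[R]_n) (b : R) f g :
  eucl_test_function V f -> eucl_test_function V g ->
  eucl_test_function V (fun x => b * f x + g x).
Proof.
move=> [sf cf fV] [sg cg gV].
apply: (@eucl_testI _ (fsupport f `|` fsupport g)).
- apply: smooth_on_add; [exact: openT| |exact: sg].
  by apply: smooth_on_mul; [exact: openT|exact: smooth_on_cst|exact: sf].
- exact: compactU.
- by rewrite subUset.
- move=> x /not_orP[/fsupport_out -> /fsupport_out ->].
  by rewrite mulr0 addr0.
Qed.

Lemma eucl_test0 (V : set 'rV[R]_n) : eucl_test_function V (fun=> 0).
Proof.
apply: (@eucl_testI _ set0) => //; [exact: smooth_on_cst|exact: compact0].
Qed.

Lemma eucl_testM (V : set 'rV[R]_n) f g : smooth_on setT f ->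
  eucl_test_function V g -> eucl_test_function V (fun x => g x * f x).
Proof.
move=> sf [sg cg gV]; apply: (@eucl_testI _ (fsupport g) _ _ cg gV).
  exact: smooth_on_mul openT sg sf.
by move=> x /fsupport_out ->; rewrite mul0r.
Qed.

Lemma iter_partialD s f g : smooth_on setT f -> smooth_on setT g ->
  iter_partial s (fun x => f x + g x) = fun x => iter_partial s f x + iter_partial s g x.
Proof.
move=> sf sg; elim: s => //= i s ->; apply/funext => x.
have df j := @smooth_on_derivable _ _ setT _ x j (smooth_on_iter s sf) I.
have dg j := @smooth_on_derivable _ _ setT _ x j (smooth_on_iter s sg) I.
exact: deriveD (df i) (dg i).
Qed.

(** Induction from the innermost derivative: it turns [q * u] into
    [q' * u + q * u'], two products of the same kind, since the derivatives of
    [u] also converge to 0 together with all of theirs. *)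
Lemma leibniz_cvg (K : set 'rV[R]_n) (u : nat -> 'rV[R]_n -> R) (q : 'rV[R]_n -> R) s :
  compact K -> (forall m, smooth_on setT (u m)) -> smooth_on setT q ->
  (forall t (e : R), 0 < e ->
    \forall m \near \oo, forall x, K x -> `|iter_partial t (u m) x| <= e) ->
  forall e : R, 0 < e ->
    \forall m \near \oo, forall x, K x -> `|iter_partial s (fun y => q y * u m y) x| <= e.
Proof.
move=> cK; elim/last_ind: s u q => [|s i IH] u q su sq hu e e0.
  have cq : continuous q by move=> x; exact: smooth_on_continuous sq I.
  have [B B0 hB] := compact_norm_bounded cq cK.
  have B1 : 0 < B + 1 by rewrite ltr_wpDl.
  have := hu [::] _ (divr_gt0 e0 B1).
  apply: filter_app; near=> m => hm x Kx /=.
  rewrite normrM (@le_trans _ _ ((B + 1) * (e / (B + 1))))//; last first.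
    by rewrite mulrC divfK// gt_eqF.
  by rewrite ler_pM//; [rewrite (le_trans (hB _ Kx))// lerDl|exact: hm].
have e2 : 0 < e / 2 by rewrite divr_gt0.
have h1 := IH u ('D_(e_ i) q) su (smooth_on_partial i sq) hu _ e2.
have h2 : \forall m \near \oo, forall x, K x ->
    `|iter_partial s (fun y => q y * 'D_(e_ i) (u m) y) x| <= e / 2.
  apply: (IH (fun m => 'D_(e_ i) (u m)) q _ sq _ _ e2).
    by move=> m; exact: smooth_on_partial (su m).
  by move=> t e' e'0; have := hu (rcons t i) _ e'0; under eq_near do rewrite iter_partial_rcons.
near=> m => x Kx.
rewrite iter_partial_rcons.
have -> : 'D_(e_ i) (fun y => q y * u m y) =
    fun y => 'D_(e_ i) q y * u m y + q y * 'D_(e_ i) (u m) y.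
  apply/funext => y.
  have dq : derivable q y (e_ i) by exact: smooth_on_derivable sq I.
  have du : derivable (u m) y (e_ i) by exact: smooth_on_derivable (su m) I.
  have := deriveM dq du; rewrite -![_ *: _]/(_ * _) => E.
  by rewrite addrC (mulrC _ (u m y)); exact: E.
rewrite iter_partialD.
- rewrite (le_trans (ler_normD _ _))// (splitr e) lerD//.
    by move: x Kx; near: m.
  by move: x Kx; near: m.
- exact: smooth_on_mul openT (smooth_on_partial i sq) (su m).
- exact: smooth_on_mul openT sq (smooth_on_partial i (su m)).
Unshelve. all: by end_near. Qed.

Lemma sup_norm_le (K : set 'rV[R]_n) g (e : R) : 0 <= e -> (forall x, K x -> `|g x| <= e) ->
  sup [set `|g x| | x in K] <= e.
Proof.
move=> e0 h; have [->|/set0P[x Kx]] := eqVneq K set0; first by rewrite image_set0 sup0.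
by apply: ge_sup; [exists `|g x|, x|move=> _ [y Ky <-]; exact: h].
Qed.

Lemma eucl_distribution_cvg (V : set 'rV[R]_n) L (K : set 'rV[R]_n)
    (u : nat -> 'rV[R]_n -> R) : eucl_distribution V L -> compact K -> K `<=` V ->
  (forall m, eucl_test_function V (u m)) -> (forall m, fsupport (u m) `<=` K) ->
  (forall t (e : R), 0 < e ->
    \forall m \near \oo, forall x, K x -> `|iter_partial t (u m) x| <= e) ->
  (fun m => L (u m)) @ \oo --> (0 : R).
Proof.
move=> [lL hL] cK KV tu sK hu; have [C [N hC]] := hL K cK KV.
pose M : R := \sum_(k < N.+1) \sum_(s : k.-tuple 'I_n) 1.
have M0 : 0 <= M by apply: sumr_ge0 => k _; apply: sumr_ge0.
apply/cvgr0Pnorm_le => e e0.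
(* One is added so as to divide by a positive number even if [C] or [M] is 0. *)
have D0 : 0 < `|C| * M + 1 by rewrite ltr_wpDl// mulr_ge0.
pose e' := e / (`|C| * M + 1).
have e'0 : 0 < e' by rewrite divr_gt0.
have H : \forall m \near \oo, forall (k : 'I_N.+1) (s : k.-tuple 'I_n), forall x, K x ->
    `|iter_partial s (u m) x| <= e'.
  apply: filter_forall => k; apply: filter_forall => s; exact: hu.
near=> m.
apply: (le_trans (hC _ (tu m) (sK m))).
apply: (@le_trans _ _ (`|C| * (M * e'))).
  have S0 : 0 <= \sum_(k < N.+1) \sum_(s : k.-tuple 'I_n) sup [set `|iter_partial s (u m) x| | x in K].
    apply: sumr_ge0 => k _; apply: sumr_ge0 => s _.
    have [->|/set0P[x Kx]] := eqVneq K set0; first by rewrite image_set0 sup0.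
    apply: (@le_trans _ _ `|iter_partial s (u m) x|) => //.
    apply: ub_le_sup; last by exists x.
    have cg : continuous (iter_partial s (u m)).
      by move=> z; have [su _ _] := tu m; exact: smooth_on_continuous (smooth_on_iter s su) I.
    have [B _ hB] := compact_norm_bounded cg cK.
    by exists B => _ [z Kz <-]; exact: hB.
  apply: (le_trans (ler_wpM2r S0 (ler_norm C))); apply: ler_wpM2l => //.
  rewrite mulr_suml; apply: ler_sum => k _; rewrite mulr_suml; apply: ler_sum => s _.
  rewrite mul1r; apply: sup_norm_le; first exact: ltW.
  by move: k s; near: m.
rewrite /e' mulrA mulrCA -[leRHS]mulr1 ler_wpM2l ?(ltW e0)//.
by rewrite ler_pdivrMr// mul1r lerDl.
Unshelve. all: by end_near. Qed.

Section disc.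
Variables (p : 'rV[R]_n) (rho : R).
Hypothesis rho_gt0 : 0 < rho.

(** The square of the Euclidean distance to [p], in units of [rho]; unlike the
    norm it is smooth. *)
Definition sqdist y : R := (\sum_(k < n) (y ord0 k - p ord0 k) ^+ 2) / rho ^+ 2.

(** This composition is how a bump centred in one chart is seen from another
    chart. *)
Lemma smooth_on_sqdist_comp n' (U : set 'rV[R]_n') (F : 'rV[R]_n' -> 'rV[R]_n) : open U ->
  (forall k, smooth_on U (fun u => F u ord0 k)) -> smooth_on U (fun u => sqdist (F u)).
Proof.
move=> oU sF; apply: (@smooth_on_mul _ _ _ _ (fun=> _)); [exact: oU| |exact: smooth_on_cst].
apply: smooth_on_sum => [|k]; first exact: oU.
have h : smooth_on U (fun u => F u ord0 k - p ord0 k).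
  by apply: smooth_on_add; [exact: oU|exact: sF|exact: smooth_on_cst].
by apply: (smooth_on_ext oU _ (smooth_on_mul oU h h)) => u _; rewrite expr2.
Qed.

Lemma smooth_sqdist : smooth_on setT sqdist.
Proof.
by apply: (@smooth_on_sqdist_comp _ _ id openT) => k; exact/smooth_on_coord/openT.
Qed.

Lemma sqdist_center : sqdist p = 0.
Proof. by rewrite /sqdist big1 ?mul0r// => k _; rewrite subrr expr0n. Qed.

Lemma sqdist_coord y k : sqdist y <= 9 -> `|y ord0 k - p ord0 k| <= 3 * rho.
Proof.
rewrite /sqdist ler_pdivrMr ?exprn_gt0// => h.
have r0 : 0 <= 3 * rho by rewrite mulr_ge0// ltW.
rewrite -(ler_pXn2r (n := 2)) ?nnegrE// real_normK ?num_real//.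
apply: le_trans (_ : _ <= 9 * rho ^+ 2) _; last by rewrite exprMn -natrX.
apply: le_trans h; rewrite (bigD1 k)//= lerDl; apply: sumr_ge0 => j _.
exact: sqr_ge0.
Qed.

Lemma compact_disc c : c <= 9 -> compact [set y | sqdist y <= c].
Proof.
move=> c9.
have cb : compact [set v : 'rV[R]_n | forall i, `[p ord0 i - 3 * rho, p ord0 i + 3 * rho]%classic (v ord0 i)].
  apply: (@rV_compact R n (fun i => `[p ord0 i - 3 * rho, p ord0 i + 3 * rho]%classic)) => i.
  exact: segment_compact.
apply: (subclosed_compact _ cb).
  apply: (@preimage_closed _ _ sqdist [set r | r <= c]).
    by move=> x _; exact: smooth_on_continuous smooth_sqdist I.
  exact: closed_le.
move=> y /= hy i; have := @sqdist_coord y i (le_trans hy c9).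
by rewrite ler_norml in_itv /=; lra.
Qed.

(** The factor 3 gives [cutoff] the value 1 on the supports [sqdist <= 2] of the
    functions to approximate, and a support within [sqdist <= 6], the size of
    the discs required of a chart. *)
Definition cutoff y : R := bump (sqdist y / 3).

Lemma smooth_cutoff : smooth_on setT cutoff.
Proof.
apply: smooth_on_bump; first exact: openT.
by apply: (@smooth_on_mul _ _ _ _ (fun=> _)); [exact: openT|exact: smooth_sqdist|exact: smooth_on_cst].
Qed.

Lemma cutoff1 y : sqdist y <= 2 -> cutoff y = 1.
Proof. by move=> h; apply: bump1; rewrite ler_pdivrMr// mul1r (le_trans h)// ler_nat. Qed.

Lemma cutoff0 y : ~ sqdist y <= 6 -> cutoff y = 0.
Proof.
move=> /negP; rewrite -ltNge => h; apply: bump0; rewrite ler_pdivlMr// -natrM.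
exact: ltW.
Qed.

(** The corner of a cube of side [6 * rho] that contains the support of
    [cutoff], since a Euclidean radius [sqrt 6] is less than 3. *)
Definition corner : 'rV[R]_n := \row_k (p ord0 k - 3 * rho).

Lemma disc_cube y : sqdist y <= 6 -> cube corner (6 * rho) y.
Proof.
move=> h k; have := @sqdist_coord y k (le_trans h _); rewrite ler_nat => /(_ isT).
by rewrite ler_norml mxE; lra.
Qed.

Variables (V : set 'rV[R]_n) (L : ('rV[R]_n -> R) -> R).
Hypothesis discV : [set y | sqdist y <= 6] `<=` V.
Hypothesis distrL : eucl_distribution V L.

Lemma test_cutoff : eucl_test_function V cutoff.
Proof.
apply: (@eucl_testI _ [set y | sqdist y <= 6]) => //.
- exact: smooth_cutoff.
- by apply: compact_disc; rewrite ler_nat.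
- by move=> x /= /cutoff0.
Qed.

Let w6 : 0 < 6 * rho. Proof. by rewrite mulr_gt0. Qed.

(** As [cutoff] is 1 on the support of [F], the error is [L] applied to
    [cutoff * (B_m F - F)], all of whose derivatives tend to 0 uniformly on the
    support of [cutoff]. *)
Theorem eucl_distribution_approx F : smooth_on setT F ->
  (forall y, ~ sqdist y <= 2 -> F y = 0) ->
  (fun m => \sum_(j < bernstein_size corner (6 * rho) m)
      F (bernstein_node corner (6 * rho) m j) *
      L (fun y => cutoff y * bernstein_weight corner (6 * rho) m j y)) @ \oo --> L F.
Proof.
move=> sF F0.
have c2 : compact [set y | sqdist y <= 2] by apply: compact_disc; rewrite ler_nat.
have c6 : compact [set y | sqdist y <= 6] by apply: compact_disc; rewrite ler_nat.
have cl6 : closed [set y | sqdist y <= 6] by apply: compact_closed => //; exact: norm_hausdorff.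
have d26 : [set y | sqdist y <= 2] `<=` [set y | sqdist y <= 6].
  by move=> y /= h; rewrite (le_trans h)// ler_nat.
have tF : eucl_test_function V F.
  by apply: (eucl_testI sF c2) => //; exact: subset_trans discV.
have [_ cF _] := tF.
pose B m := bernstein corner (6 * rho) m F.
have sB m : smooth_on setT (B m).
  have h : smooth_on setT (fun y => \sum_(j < bernstein_size corner (6 * rho) m)
      bernstein_weight corner (6 * rho) m j y * F (bernstein_node corner (6 * rho) m j)).
    apply: smooth_on_sum; first exact: openT.
    move=> j; apply: smooth_on_mul; [exact: openT|exact: smooth_bernstein_weight|exact: smooth_on_cst].
  by apply: (smooth_on_ext openT _ h) => y _; rewrite /B bernsteinE.
pose u m y := -1 * F y + B m y.
have su m : smooth_on setT (u m).
  apply: smooth_on_add; [exact: openT| |exact: sB].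
  by apply: smooth_on_mul; [exact: openT|exact: smooth_on_cst|].
pose q m y := cutoff y * u m y.
have tq m : eucl_test_function V (q m) by exact: eucl_testM (su m) test_cutoff.
have Lq : (fun m => L (q m)) @ \oo --> (0 : R).
  apply: (eucl_distribution_cvg distrL c6 discV tq).
    by move=> m; apply: fsupport_sub => // x /cutoff0 h; rewrite /q h mul0r.
  move=> t e e0; apply: (leibniz_cvg t c6 su smooth_cutoff _ e0) => t' e' e'0.
  have := bernstein_cvg corner w6 t' sF cF e'0.
  apply: filter_app; near=> m => hm x /disc_cube cx.
  have -> : iter_partial t' (u m) = fun x => -1 * iter_partial t' F x + iter_partial t' (B m) x.
    rewrite /u iter_partialD; [|exact: smooth_on_mul openT (smooth_on_cst _) sF|exact: sB].
    apply/funext => z; congr (_ + _).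
    elim: t' {hm} z => //= i t' IH z.
    rewrite (_ : iter_partial t' (fun y => -1 * F y) = -1 *: iter_partial t' F).
      by rewrite deriveZ//; exact: smooth_on_derivable (smooth_on_iter t' sF) I.
    exact/funext.
  rewrite mulN1r addrC; exact: hm.
have LE m : \sum_(j < bernstein_size corner (6 * rho) m)
      F (bernstein_node corner (6 * rho) m j) *
      L (fun y => cutoff y * bernstein_weight corner (6 * rho) m j y) = L (q m) + L F.
  have [lL _] := distrL.
  rewrite -(linear_on_sum _ _ lL (@eucl_test0 V) (@eucl_test_lin V)); last first.
    by move=> j; apply: eucl_testM test_cutoff; exact: smooth_bernstein_weight.
  rewrite -[L (q m)]mul1r -lL//; congr (L _); apply/funext => y.
  rewrite /q /u /B bernsteinE mul1r mulrDr mulr_sumr.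
  have -> : cutoff y * (-1 * F y) = - F y.
    have [/cutoff1 ->|/F0 ->] := pselect (sqdist y <= 2); first by rewrite mul1r mulN1r.
    by rewrite !mulr0 oppr0.
  rewrite addrAC addNr add0r; apply: eq_bigr => j _; ring.
rewrite (_ : (fun m => _) = (fun m => L (q m) + L F)); last exact/funext.
rewrite -[X in _ --> X]add0r; apply: cvgD => //; exact: cvg_cst.
Unshelve. all: by end_near. Qed.

End disc.

End euclid.

(** * Distributions on manifolds as limits of point masses *)

Lemma restr_in {R : realType} {T : Type} (f : T -> R) (D : set T) x : D x -> (f \_ D) x = f x.
Proof. by move=> Dx; rewrite patchE mem_set. Qed.

Lemma restr_out {R : realType} {T : Type} (f : T -> R) (D : set T) x : ~ D x -> (f \_ D) x = 0.
Proof. by move=> Dx; rewrite patchE memNset. Qed.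

Lemma open_preimageI {T U : topologicalType} (f : T -> U) (D : set T) (O : set U) :
  open D -> (forall x, D x -> {for x, continuous f}) -> open O -> open (D `&` f @^-1` O).
Proof.
move=> oD cf oO; rewrite openE => x [Dx Ofx].
apply: filterI; first exact: open_nbhs_nbhs.
by apply: (cf _ Dx); exact: open_nbhs_nbhs.
Qed.

(** A basic set contained in some [W x] determines one such [x], and basic sets
    can be numbered. *)
Lemma second_countable_subcover {T : ptopologicalType} (W : T -> set T) :
  @second_countable T -> (forall x, open (W x)) -> (forall x, W x x) ->
  exists xs : nat -> T, forall y, exists m, W (xs m) y.
Proof.
move=> [B /countable_injP [c cI] [oB bB]] oW Wx.
pose Q m x := exists U, [/\ B U, c U = m & U `<=` W x].
exists (fun m => if pselect (exists x, Q m x) is left h then projT1 (cid h) else point) => y.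
have [U [/= BU Uy] UW] := bB y _ (open_nbhs_nbhs (conj (oW y) (Wx y))).
exists (c U); case: pselect => [h|[]]; last by exists y, U.
case: (cid h) => /= x [U' [BU' cU' U'W]].
by apply: U'W; rewrite (cI _ _ _ _ cU') ?in_setE.
Qed.

Section manifold.
Context {R : realType} {n : nat} {P : ptopologicalType}.
Hypothesis hausP : hausdorff_space P.
Variable S : smooth_structure R n P.
Implicit Types (f g : P -> R) (c : chart R n P).

Definition smooth_fun f := forall c, charts S c -> smooth_on (chart_img c) (f \o chart_inv c).

Lemma smooth_fun_cst (b : R) : smooth_fun (fun=> b).
Proof. by move=> c _; exact: smooth_on_cst. Qed.

Lemma smooth_fun_mul f g : smooth_fun f -> smooth_fun g -> smooth_fun (fun x => f x * g x).
Proof. by move=> sf sg c Sc; apply: smooth_on_mul (sf _ Sc) (sg _ Sc); exact: chart_img_open. Qed.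

Lemma smooth_fun_add f g : smooth_fun f -> smooth_fun g -> smooth_fun (fun x => f x + g x).
Proof. by move=> sf sg c Sc; apply: smooth_on_add (sf _ Sc) (sg _ Sc); exact: chart_img_open. Qed.

Lemma smooth_fun_prod (I : Type) (r : seq I) (F : I -> P -> R) :
  (forall i, smooth_fun (F i)) -> smooth_fun (fun x => \prod_(i <- r) F i x).
Proof.
move=> sF; elim: r => [|i r IH].
  rewrite (_ : (fun x => _) = fun=> 1); first exact: smooth_fun_cst.
  by apply/funext => x; rewrite big_nil.
rewrite (_ : (fun x => _) = fun x => F i x * \prod_(j <- r) F j x).
  exact: smooth_fun_mul (sF i) IH.
by apply/funext => x; rewrite big_cons.
Qed.

Lemma smooth_fun_continuous f : smooth_fun f -> continuous f.
Proof.
move=> sf x; have [c Sc cx] := charts_cover S x.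
have h : {for x, continuous ((f \o chart_inv c) \o chart_map c)}.
  apply: continuous_comp; first exact: chart_map_cont.
  by apply: smooth_on_continuous (sf _ Sc) _; exists x.
have fE : {near nbhs x, (f \o chart_inv c) \o chart_map c =1 f}.
  near=> y; rewrite /= chart_mapK//; near: y.
  by apply: open_nbhs_nbhs; split=> //; exact: chart_dom_open.
move: h; rewrite /prop_for /continuous_at [X in _ --> X]/= chart_mapK// => h.
exact: cvg_trans (near_eq_cvg fE) h.
Unshelve. all: by end_near. Qed.

Lemma test_functionI f (K : set P) : smooth_fun f -> compact K ->
  (forall x, ~ K x -> f x = 0) -> test_function S f.
Proof.
move=> sf cK f0; split=> //.
have clK : closed K by exact: compact_closed.
apply: subclosed_compact cK (fsupport_sub clK f0); exact: closed_closure.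
Qed.

Lemma test_function_mul f g : smooth_fun g -> test_function S f ->
  test_function S (fun x => g x * f x).
Proof.
move=> sg [sf cf]; apply: (test_functionI _ cf); first exact: smooth_fun_mul.
by move=> x /fsupport_out ->; rewrite mulr0.
Qed.

Lemma test_function_lin (b : R) f g : test_function S f -> test_function S g ->
  test_function S (fun x => b * f x + g x).
Proof.
move=> [sf cf] [sg cg]; apply: (test_functionI _ (compactU cf cg)).
  exact: smooth_fun_add (smooth_fun_mul (smooth_fun_cst b) sf) sg.
by move=> x /not_orP[/fsupport_out -> /fsupport_out ->]; rewrite mulr0 addr0.
Qed.

Lemma test_function0 : test_function S (fun=> 0).
Proof. by apply: (test_functionI (smooth_fun_cst 0) compact0). Qed.

Lemma chart_imgP c y : chart_img c y -> chart_dom c (chart_inv c y) /\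
  chart_map c (chart_inv c y) = y.
Proof. by move=> [x cx <-]; rewrite chart_mapK. Qed.

Section chart_bump.
Variables (c : chart R n P) (p : 'rV[R]_n) (rho : R).
Hypotheses (Sc : charts S c) (rho_gt0 : 0 < rho).
Hypothesis disc_img : [set y | sqdist p rho y <= 6] `<=` chart_img c.

Definition pdisc : set P := chart_inv c @` [set y | sqdist p rho y <= 2].

Let disc_img2 : [set y | sqdist p rho y <= 2] `<=` chart_img c.
Proof. by move=> y h; apply: disc_img; rewrite /= (le_trans h)// ler_nat. Qed.

Let compact_disc2 : compact [set y | sqdist p rho y <= 2].
Proof. by apply: compact_disc => //; rewrite ler_nat. Qed.

Lemma pdisc_dom : pdisc `<=` chart_dom c.
Proof. by move=> _ [y hy <-]; have [] := chart_imgP (disc_img2 hy). Qed.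

Lemma compact_pdisc : compact pdisc.
Proof.
apply: continuous_compact compact_disc2.
apply: continuous_in_subspaceT.
by move=> y hy; apply: chart_inv_cont; apply: disc_img2; rewrite in_setE in hy.
Qed.

Lemma closed_pdisc : closed pdisc.
Proof. exact: compact_closed compact_pdisc. Qed.

Lemma pdiscP x : pdisc x -> sqdist p rho (chart_map c x) <= 2.
Proof. by move=> [y hy <-]; rewrite (chart_imgP (disc_img2 hy)).2. Qed.

Lemma pdiscI x : chart_dom c x -> sqdist p rho (chart_map c x) <= 2 -> pdisc x.
Proof. by move=> cx hx; exists (chart_map c x) => //; rewrite chart_mapK. Qed.

Definition chart_bump : P -> R := (fun x => bump (sqdist p rho (chart_map c x))) \_ (chart_dom c).

Lemma chart_bump_out x : ~ pdisc x -> chart_bump x = 0.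
Proof.
move=> hx; have [cx|cx] := pselect (chart_dom c x); last exact: restr_out.
rewrite /chart_bump restr_in//; apply: bump0; rewrite leNgt; apply/negP => h.
by apply: hx; apply: pdiscI => //; exact: ltW.
Qed.

Lemma chart_bump1 x : chart_dom c x -> sqdist p rho (chart_map c x) <= 1 -> chart_bump x = 1.
Proof. by move=> cx h; rewrite /chart_bump restr_in// bump1. Qed.

Lemma open_chart_preimage c' (O : set P) : open O -> open (chart_img c' `&` chart_inv c' @^-1` O).
Proof.
by move=> oO; apply: open_preimageI => //; [exact: chart_img_open|exact: chart_inv_cont].
Qed.

(** Seen from another chart, the bump is a function of the transition map on the
    overlap, and it vanishes off the compact set [pdisc], which is closed since
    [P] is Hausdorff.  These two open regions cover the chart. *)
Lemma smooth_chart_bump : smooth_fun chart_bump.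
Proof.
move=> c' Sc'.
set A := chart_map c' @` (chart_dom c' `&` chart_dom c).
have AE : A = chart_img c' `&` chart_inv c' @^-1` (chart_dom c).
  apply/seteqP; split=> [_ [x [c'x cx] <-]|y [[x c'x <-]]].
    by split; [exists x|rewrite /= chart_mapK].
  by rewrite /= chart_mapK// => cx; exists x.
have oA : open A by rewrite AE; apply: open_chart_preimage; exact: chart_dom_open.
set B := chart_img c' `&` chart_inv c' @^-1` (~` pdisc).
have oB : open B by apply: open_chart_preimage; apply: closed_openC; exact: closed_pdisc.
apply: (@smooth_on_sub _ _ (A `|` B)).
  move=> y c'y; have [Q|Q] := pselect (pdisc (chart_inv c' y)); [left|by right].
  by rewrite AE; split => //; exact: pdisc_dom.
apply: smooth_on_union.
  have h : smooth_on A (fun y => bump (sqdist p rho (chart_map c (chart_inv c' y)))).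
    apply: smooth_on_bump => //.
    apply: smooth_on_sqdist_comp => // i.
    exact: (charts_compat Sc' Sc).
  apply: (smooth_on_ext oA _ h) => y; rewrite AE => -[_ cy].
  by rewrite /= /chart_bump restr_in.
apply: (smooth_on_ext oB _ (@smooth_on_cst _ _ B 0)) => y [_ By].
by rewrite /= chart_bump_out.
Qed.

Definition chart_ext f : 'rV[R]_n -> R := (f \o chart_inv c) \_ (chart_img c).

Lemma chart_ext_out f y : (forall x, ~ pdisc x -> f x = 0) ->
  ~ sqdist p rho y <= 2 -> chart_ext f y = 0.
Proof.
move=> f0 hy; have [cy|cy] := pselect (chart_img c y); last exact: restr_out.
have [_ ky] := chart_imgP cy.
rewrite /chart_ext restr_in//=; apply: f0 => /pdiscP.
by rewrite ky.
Qed.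

Lemma smooth_chart_ext f : smooth_fun f -> (forall x, ~ pdisc x -> f x = 0) ->
  smooth_on setT (chart_ext f).
Proof.
move=> sf f0.
have cl2 : closed [set y | sqdist p rho y <= 2].
  by apply: compact_closed compact_disc2; exact: norm_hausdorff.
apply: (@smooth_on_sub _ _ (chart_img c `|` ~` [set y | sqdist p rho y <= 2])).
  move=> y _; have [h|h] := pselect (sqdist p rho y <= 2); last by right.
  by left; exact: disc_img2.
apply: smooth_on_union.
  apply: (smooth_on_ext _ _ (sf _ Sc)); first exact: chart_img_open.
  by move=> y cy; rewrite /chart_ext restr_in.
have oD := closed_openC cl2.
apply: (smooth_on_ext oD _ (@smooth_on_cst _ _ _ 0)) => y hy.
by rewrite chart_ext_out.
Qed.

Lemma chart_pushforward_ext (eta : (P -> R) -> R) f : (forall x, ~ pdisc x -> f x = 0) ->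
  chart_pushforward c eta (chart_ext f) = eta f.
Proof.
move=> f0; rewrite /chart_pushforward; congr (eta _); apply/funext => x.
have [cx|cx] := pselect (chart_dom c x).
  rewrite restr_in//= /chart_ext restr_in /=; last by exists x.
  by rewrite chart_mapK.
by rewrite restr_out// f0// => /pdisc_dom.
Qed.

End chart_bump.

Lemma chart_disc_exists x : exists (c : chart R n P) (rho : R),
  [/\ charts S c, chart_dom c x, 0 < rho &
      [set y | sqdist (chart_map c x) rho y <= 6] `<=` chart_img c].
Proof.
have [c Sc cx] := charts_cover S x.
have : nbhs (chart_map c x) (chart_img c).
  by apply: open_nbhs_nbhs; split; [exact: chart_img_open|exists x].
move=> /rV_nbhsP [e e0 he].
have r0 : 0 < e / 4 by rewrite divr_gt0.
exists c, (e / 4); split=> // y /= hy; apply: he => k.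
rewrite distrC; have := @sqdist_coord _ _ _ _ r0 y k (le_trans hy _).
rewrite ler_nat => /(_ isT) h; apply: (le_lt_trans h).
lra.
Qed.

Hypothesis countP : @second_countable P.

(** Each point is the centre of a disc in some chart, with room for the cutoffs.
    The inner discs have interiors that cover [P]; second countability extracts
    a sequence of them, and compactness finitely many. *)
Lemma countable_chart_discs : exists (c : nat -> chart R n P) (p : nat -> 'rV[R]_n) (rho : nat -> R),
  (forall i, [/\ charts S (c i), 0 < rho i &
      [set y | sqdist (p i) (rho i) y <= 6] `<=` chart_img (c i)]) /\
  forall K : set P, compact K -> \forall m \near \oo, forall x, K x ->
    exists2 i : 'I_m, chart_dom (c i) x & sqdist (p i) (rho i) (chart_map (c i) x) <= 1.
Proof.
pose c x := projT1 (cid (chart_disc_exists x)).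
pose r x := projT1 (cid (projT2 (cid (chart_disc_exists x)))).
have cr x : [/\ charts S (c x), chart_dom (c x) x, 0 < r x &
    [set y | sqdist (chart_map (c x) x) (r x) y <= 6] `<=` chart_img (c x)].
  exact: (projT2 (cid (projT2 (cid (chart_disc_exists x))))).
pose W x := chart_dom (c x) `&`
  chart_map (c x) @^-1` [set y | sqdist (chart_map (c x) x) (r x) y < 1].
have oW x : open (W x).
  apply: open_preimageI; [exact: chart_dom_open|exact: chart_map_cont|].
  rewrite (_ : mkset _ = setT `&` sqdist (chart_map (c x) x) (r x) @^-1` [set t | t < 1]).
    apply: open_preimageI; [exact: openT| |exact: open_lt].
    by move=> y _; apply: smooth_on_continuous I; exact: smooth_sqdist.
  by rewrite setTI.
have Wx x : W x x.
  by have [_ cx _ _] := cr x; split => //=; rewrite sqdist_center.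
have [xs hxs] := second_countable_subcover countP oW Wx.
exists (c \o xs), (fun i => chart_map (c (xs i)) (xs i)), (r \o xs); split.
  by move=> i; have [? ? ? ?] := cr (xs i).
move=> K /compact_near_coveringP cK.
have : \forall m \near \oo, K `<=` [set x | exists2 i : 'I_m, chart_dom (c (xs i)) x &
    sqdist (chart_map (c (xs i)) (xs i)) (r (xs i)) (chart_map (c (xs i)) x) <= 1].
  apply: cK => x _; have [i Wi] := hxs x.
  have Wn : nbhs x (W (xs i)) by apply: open_nbhs_nbhs.
  near=> x' m.
  have im : (i < m)%N by near: m; exact: nbhs_infty_gt.
  have [h1 h2] : W (xs i) x' by near: x'; exact: Wn.
  by exists (Ordinal im) => //=; exact: ltW.
apply: filter_app; near=> m => h x Kx; exact: h.
Unshelve. all: by end_near. Qed.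

(** The term [i] is the decrease of the partial products of [1 - th j] from rank
    [i] to rank [i + 1]. *)
Lemma telescope_partition (th : nat -> R) m :
  \sum_(i < m) th i * \prod_(j < i) (1 - th j) = 1 - \prod_(j < m) (1 - th j).
Proof.
elim: m => [|m IH]; first by rewrite !big_ord0 subrr.
by rewrite !big_ord_recr /= IH; ring.
Qed.

(** Only the first [m] pieces [chi_i f] enter the [m]-th combination, so that it
    has finitely many point masses; for a fixed test function the pieces beyond
    some rank [M] vanish, and the limit is a finite sum of limits. *)
Theorem distribution_dirac_cvg (eta : (P -> R) -> R) : distribution S eta ->
  exists pts : nat -> seq (R * P), forall f, test_function S f ->
    (fun m => \sum_(q <- pts m) q.1 * f q.2) @ \oo --> eta f.
Proof.
move=> [leta deta].
have [c [p [rho [hc cov]]]] := countable_chart_discs.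
pose th i := chart_bump (c i) (p i) (rho i).
have sth i : smooth_fun (th i) by have [Sc r0 h] := hc i; exact: smooth_chart_bump.
pose chi i x := th i x * \prod_(j < i) (1 - th j x).
have schi i : smooth_fun (chi i).
  apply: smooth_fun_mul => //; apply: smooth_fun_prod => j.
  apply: smooth_fun_add; first exact: smooth_fun_cst.
  have := smooth_fun_mul (smooth_fun_cst (-1)) (sth j).
  by under [X in smooth_fun X]eq_fun do rewrite mulN1r.
have chi0 i x : ~ pdisc (c i) (p i) (rho i) x -> chi i x = 0.
  by move=> h; rewrite /chi /th chart_bump_out ?mul0r//; have [] := hc i.
pose a i := corner (p i) (rho i).
pose w i := 6 * rho i.
pose L i := chart_pushforward (c i) eta.
pose wt i m (j : nat) : R := L i (fun y => cutoff (p i) (rho i) y * bernstein_weight (a i) (w i) m j y).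
pose node i m j := bernstein_node (a i) (w i) m j.
pose sz i m := bernstein_size (a i) (w i) m.
pose pts m := flatten [seq [seq
    ((chi i \o chart_inv (c i)) \_ (chart_img (c i)) (node i m j) * wt i m j,
      chart_inv (c i) (node i m j)) | j <- index_iota 0 (sz i m)] | i <- index_iota 0 m].
exists pts => f tf; have [sf cf] := tf.
have ptsE m : \sum_(q <- pts m) q.1 * f q.2 = \sum_(i < m) \sum_(j < sz i m)
    chart_ext (c i) (fun x => chi i x * f x) (node i m j) * wt i m j.
  rewrite big_flatten big_map big_mkord.
  apply: eq_bigr => i _; rewrite big_map big_mkord.
  apply: eq_bigr => j _ /=; rewrite /chart_ext.
  have [h|h] := pselect (chart_img (c i) (node i m j)).
    by rewrite !restr_in//= mulrAC.
  by rewrite !restr_out// !mul0r.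
have tchi i : test_function S (fun x => chi i x * f x) by exact: test_function_mul (schi i) tf.
have chif0 i x : ~ pdisc (c i) (p i) (rho i) x -> chi i x * f x = 0.
  by move=> /chi0 ->; rewrite mul0r.
have cvgi i : (fun m => \sum_(j < sz i m)
    chart_ext (c i) (fun x => chi i x * f x) (node i m j) * wt i m j) @ \oo -->
    eta (fun x => chi i x * f x).
  have [Sc r0 h] := hc i.
  rewrite -(chart_pushforward_ext h eta (@chif0 i)).
  apply: (eucl_distribution_approx r0 h (deta _ Sc)).
    by apply: (smooth_chart_ext Sc r0 h); [have [] := tchi i|exact: chif0].
  by move=> y; apply: (chart_ext_out h); exact: chif0.
(* The support of [f] lies in the union of the first [M] inner discs, so one of
   the factors [1 - th j] vanishes at each of its points. *)
have [M _ hM] := cov _ cf.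
have prod0 m x : (M <= m)%N -> fsupport f x -> \prod_(j < m) (1 - th j x) = 0.
  move=> Mm fx; have [i cx hx] := hM m Mm x fx.
  by rewrite (bigD1 i)//= /th chart_bump1// subrr mul0r.
have chiM i x : (M <= i)%N -> chi i x * f x = 0.
  move=> Mi; have [fx|/fsupport_out ->] := pselect (fsupport f x); last by rewrite mulr0.
  by rewrite /chi prod0// mulr0 mul0r.
have etaE : eta f = \sum_(i < M) eta (fun x => chi i x * f x).
  have := linear_on_sum (index_enum 'I_M) (fun=> 1) leta test_function0 test_function_lin (fun i : 'I_M => tchi i).
  under [in RHS]eq_bigr do rewrite mul1r.
  move=> <-; congr (eta _); apply/funext => x.
  under eq_bigr do rewrite mul1r.
  rewrite -mulr_suml (telescope_partition (th ^~ x)).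
  have [fx|/fsupport_out ->] := pselect (fsupport f x); last by rewrite mulr0.
  by rewrite prod0// subr0 mul1r.
rewrite etaE.
have : (fun m => \sum_(i < M) \sum_(j < sz i m)
    chart_ext (c i) (fun x => chi i x * f x) (node i m j) * wt i m j) @ \oo -->
    \sum_(i < M) eta (fun x => chi i x * f x).
  by apply: cvg_big => [|i _]; [exact: add_continuous|exact: cvgi].
apply: cvg_trans; apply: near_eq_cvg; near=> m.
have Mm : (M <= m)%N by near: m; exact: nbhs_infty_ge.
rewrite ptsE -(subnKC Mm) big_split_ord /= [X in _ = _ + X]big1 ?addr0// => i _.
rewrite big1// => j _.
rewrite (_ : (fun x => _) = fun=> 0); last by apply/funext => x; rewrite chiM// leq_addr.
by rewrite /chart_ext patchE /=; case: ifP => _; rewrite ?mul0r.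
Unshelve. all: by end_near. Qed.

End manifold.

(** * Signed measures *)

Section measures.
Context {R : realType} {P : ptopologicalType}.
Implicit Types (f g : P -> R).

Lemma open_borel (U : set P) : open U -> measurable (U : set (borel P)).
Proof. by move=> oU; apply: sub_sigma_algebra. Qed.

Lemma continuous_borel_measurable f : continuous f ->
  measurable_fun [set: borel P] (f : borel P -> R).
Proof.
move=> /continuousP cf; apply: (measurability _ (RGenOpens.measurableE R)).
move=> _ [_ [a [b ->] <-]]; rewrite setTI; apply: open_borel.
exact/cf/interval_open.
Qed.

Lemma integrable_bounded (nu : {finite_measure set (borel P) -> \bar R}) f (B : R) :
  continuous f -> (forall x, `|f x| <= B) -> nu.-integrable [set: borel P] (EFin \o f).
Proof.
move=> cf hB; apply: measurable_bounded_integrable => //.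
- by rewrite -ge0_fin_numE//; exact: fin_num_measure.
- exact: continuous_borel_measurable.
- exists B; split; first exact: num_real.
  by move=> M BM x _; rewrite /= (le_trans (hB x))// ltW.
Qed.

Lemma fin_num_transpose (p q r s : \bar R) :
  p \is a fin_num -> q \is a fin_num -> r \is a fin_num -> s \is a fin_num ->
  (p - q = r - s -> r + q = p + s)%E.
Proof.
move: p q r s => [p| |] [q| |] [r| |] [s| |] //= _ _ _ _ /(congr1 fine) /= H.
by congr (_%:E); lra.
Qed.

Lemma fine_transpose (p q r s : \bar R) :
  r \is a fin_num -> s \is a fin_num -> p \is a fin_num -> q \is a fin_num ->
  (r + q = p + s)%E -> fine r - fine s = fine p - fine q.
Proof.
move: p q r s => [p| |] [q| |] [r| |] [s| |] //= _ _ _ _ /(congr1 fine) /= H.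
lra.
Qed.

(** If [J+ - J-] is the Jordan decomposition of [nu1 - nu2], the finite measures
    [J+ + nu2] and [nu1 + J-] coincide, and so do their integrals. *)
Lemma charge_integral_diff (nu1 nu2 : {finite_measure set (borel P) -> \bar R}) f (B : R) :
  continuous f -> (forall x, `|f x| <= B) ->
  charge_integral (cadd (charge_of_finite_measure nu1) (copp (charge_of_finite_measure nu2))) f =
  \int[nu1]_x f x - \int[nu2]_x f x.
Proof.
move=> cf hB; rewrite /charge_integral.
set nu := cadd _ _; set PN := projT2 (cid (projT2 (cid (Hahn_decomposition nu)))).
have mf : measurable_fun [set: borel P] (EFin \o f).
  by apply/measurable_EFinP; exact: continuous_borel_measurable.
have int (m : {finite_measure set (borel P) -> \bar R}) := integrable_bounded m cf hB.
have E : (\int[jordan_pos PN]_x (f x)%:E + \int[nu2]_x (f x)%:E =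
    \int[nu1]_x (f x)%:E + \int[jordan_neg PN]_x (f x)%:E)%E.
  rewrite -!integral_measure_add//; try exact: int.
  apply: eq_measure_integral => A mA _.
  rewrite -[LHS]/(measure_add (jordan_pos PN) nu2 A) -[RHS]/(measure_add nu1 (jordan_neg PN) A) !measure_addE.
  have D : (nu1 A - nu2 A = jordan_pos PN A - jordan_neg PN A)%E.
    apply: etrans (jordan_decomp PN mA) _.
    by rewrite /cadd /= cscaleN1.
  have f1 := fin_num_measure nu1 A mA; have f2 := fin_num_measure nu2 A mA.
  have f3 := fin_num_measure (jordan_pos PN) A mA.
  have f4 := fin_num_measure (jordan_neg PN) A mA.
  exact: fin_num_transpose f1 f2 f3 f4 D.
have F (m : {finite_measure set (borel P) -> \bar R}) : (\int[m]_x (f x)%:E)%E \is a fin_num.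
  by apply: integrable_fin_num => //; exact: int.
rewrite /Rintegral.
have /= F1 := F (jordan_pos PN : {finite_measure set (borel P) -> \bar R}).
have /= F2 := F (jordan_neg PN : {finite_measure set (borel P) -> \bar R}).
have F3 := F nu1; have F4 := F nu2.
exact: fine_transpose F1 F2 F3 F4 E.
Qed.

(** Differences of two finite measures are easier to enlarge by a point mass
    than charges, whose Hahn decomposition would change. *)
Definition finite_signed (m : (P -> R) -> R) : Prop :=
  exists nu1 nu2 : {finite_measure set (borel P) -> \bar R},
    forall f (B : R), continuous f -> (forall x, `|f x| <= B) ->
      m f = \int[nu1]_x f x - \int[nu2]_x f x.

Lemma finite_signed_charge (m : (P -> R) -> R) : finite_signed m ->
  exists nu : {charge set (borel P) -> \bar R}, forall f (B : R), continuous f ->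
    (forall x, `|f x| <= B) -> m f = charge_integral nu f.
Proof.
move=> [nu1 [nu2 h]].
exists (cadd (charge_of_finite_measure nu1) (copp (charge_of_finite_measure nu2))).
by move=> f B cf hB; rewrite (charge_integral_diff nu1 nu2 cf hB) (h f B).
Qed.

Section finite_add.
Variables (m1 m2 : {finite_measure set (borel P) -> \bar R}).

Definition finite_measure_add : set (borel P) -> \bar R := measure_add m1 m2.
HB.instance Definition _ := Measure.on finite_measure_add.
Let finite_measure_add_fin : fin_num_fun finite_measure_add.
Proof. by move=> A mA; rewrite /finite_measure_add measure_addE fin_numD !fin_num_measure. Qed.
HB.instance Definition _ := @Measure_isFinite.Build _ _ _ finite_measure_add finite_measure_add_fin.

Lemma Rintegral_finite_measure_add f (B : R) : continuous f -> (forall x, `|f x| <= B) ->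
  \int[finite_measure_add]_x f x = \int[m1]_x f x + \int[m2]_x f x.
Proof.
move=> cf hB.
have i1 := integrable_bounded m1 cf hB.
have i2 := integrable_bounded m2 cf hB.
have mf : measurable_fun [set: borel P] (EFin \o f).
  by apply/measurable_EFinP; exact: continuous_borel_measurable.
rewrite /Rintegral /finite_measure_add integral_measure_add//.
by rewrite fineD//; apply: integrable_fin_num.
Qed.

End finite_add.

Lemma Rintegral_scaled_dirac (a : P) (k : {nonneg R}) f : continuous f ->
  \int[mscale k (\d_(a : borel P))]_x f x = k%:num * f a.
Proof.
move=> cf.
have mf : measurable_fun [set: borel P] (EFin \o f).
  by apply/measurable_EFinP; exact: continuous_borel_measurable.
have mp : measurable_fun [set: borel P] ((fun x : borel P => (f x)%:E)^\+)%E.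
  exact: (measurable_funepos mf).
have mn : measurable_fun [set: borel P] ((fun x : borel P => (f x)%:E)^\-)%E.
  exact: (measurable_funeneg mf).
rewrite /Rintegral integralE !ge0_integral_mscale// !integral_dirac//.
rewrite !diracT !mul1e -muleBr//.
  have E := congr1 (@^~ a) (funeposneg (fun x : borel P => (f x)%:E)).
  by rewrite -[X in (_ * X)%E]E.
exact: add_def_funeposneg.
Qed.

Lemma finite_signed_add_dirac (m : (P -> R) -> R) (k : R) (a : P) :
  finite_signed m -> finite_signed (fun f => m f + k * f a).
Proof.
move=> [nu1 [nu2 h]].
have [k0|k0] := leP 0 k.
  exists (finite_measure_add nu1 (mscale (NngNum k0) (\d_(a : borel P)))), nu2 => f B cf hB.
  rewrite (Rintegral_finite_measure_add _ _ cf hB) Rintegral_scaled_dirac// (h f B cf hB) /=.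
  by lra.
have k1 : 0 <= - k by rewrite oppr_ge0 ltW.
exists nu1, (finite_measure_add nu2 (mscale (NngNum k1) (\d_(a : borel P)))) => f B cf hB.
rewrite (Rintegral_finite_measure_add _ _ cf hB) Rintegral_scaled_dirac// (h f B cf hB) /=.
by lra.
Qed.

Lemma finite_signed_add_diracs (m : (P -> R) -> R) (s : seq (R * P)) :
  finite_signed m -> finite_signed (fun f => m f + \sum_(q <- s) q.1 * f q.2).
Proof.
move=> hm; elim/last_ind: s => [|s q IH].
  have [nu1 [nu2 h]] := hm; exists nu1, nu2 => f B cf hB.
  by rewrite big_nil addr0; exact: h cf hB.
have [nu1 [nu2 h]] := finite_signed_add_dirac q.1 q.2 IH; exists nu1, nu2 => f B cf hB.
by rewrite -(h f B cf hB) -cats1 big_cat big_seq1 /= addrA.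
Qed.

Variable mu : {measure set (borel P) -> \bar R}.

(** Near a point, [mu] may be replaced by its restriction to a neighbourhood of
    finite measure. *)
Lemma Rintegral_restr (U : set P) (mU : measurable (U : set (borel P)))
    (muU : (mu U < +oo)%E) f : fsupport f `<=` U ->
  \int[mfrestr mU muU]_x f x = \int[mu]_x f x.
Proof.
move=> fU.
have fE : (EFin \o f) \_ U = EFin \o f.
  apply/funext => x; rewrite patchE; case: ifPn => //= /negP.
  by rewrite in_setE => Ux; rewrite (@fsupport_out _ _ f x)// => /fU.
rewrite /Rintegral -[in LHS](_ : (fun x => (f x)%:E) \_ U = (fun x => (f x)%:E)) //.
rewrite -[in RHS](_ : (fun x => (f x)%:E) \_ U = (fun x => (f x)%:E)) //.
rewrite -!integral_mkcond; congr (fine _).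
by apply: eq_measure_integral => A mA AU; rewrite /= /mfrestr /mrestr setIidl.
Qed.

Hypothesis mu_lf : locally_finite_measure mu.

Lemma compact_finite_measure_nbhd (K : set P) : compact K ->
  exists U : set P, [/\ open U, K `<=` U & (mu U < +oo)%E].
Proof.
rewrite compact_cover => cK.
pose U x := projT1 (cid (mu_lf x)).
have hU x : [/\ open (U x), U x x & (mu (U x) < +oo)%E] := projT2 (cid (mu_lf x)).
have [] := cK P setT U.
- by move=> x _; have [] := hU x.
- by move=> x _; exists x => //; have [] := hU x.
move=> D _ KD; exists (\bigcup_(x in [set` D]) U x).
rewrite bigcup_fset.
have [oD finD] : open (\big[setU/set0]_(x <- finmap.enum_fset D) U x) /\ (mu (\big[setU/set0]_(x <- finmap.enum_fset D) U x) < +oo)%E.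
  apply: (big_ind (fun A : set P => open A /\ (mu A < +oo)%E)).
  - by split; [exact: open0|rewrite measure0].
  - move=> A B [oA fA] [oB fB]; split; first exact: openU.
    apply: (@le_lt_trans _ _ (mu A + mu B)%E); last exact: lte_add_pinfty.
    by apply: measureU2; exact: open_borel.
  - by move=> x _; have [] := hU x.
by split=> //; rewrite -bigcup_fset.
Qed.

Lemma integrable_csupp f : continuous f -> compact (fsupport f) ->
  mu.-integrable [set: borel P] (EFin \o f).
Proof.
move=> cf cs; have [U [oU fU finU]] := compact_finite_measure_nbhd cs.
have [B B0 hB] := csupp_norm_bounded cf cs.
have fE : (EFin \o f) \_ U = EFin \o f.
  apply/funext => x; rewrite patchE; case: ifPn => //= /negP.
  by rewrite in_setE => Ux; rewrite (@fsupport_out _ _ f x)// => /fU.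
rewrite -fE; apply: (iffLR (integrable_mkcond _ (open_borel oU))).
apply: measurable_bounded_integrable => //.
- exact: open_borel.
- exact: measurable_funTS (continuous_borel_measurable cf).
- exists B; split; first exact: num_real.
  by move=> M BM x _; rewrite /= (le_trans (hB x))// ltW.
Qed.

End measures.

Section signed.
Context {R : realType} {n : nat} {P : ptopologicalType}.
Variable S : smooth_structure R n P.
Variable mu : {measure set (borel P) -> \bar R}.
Hypothesis mu_lf : locally_finite_measure mu.

Lemma signed_measure_add_diracs (s : seq (R * P)) :
  signed_measure S (fun f => \int[mu]_x f x + \sum_(q <- s) q.1 * f q.2).
Proof.
split.
  move=> a f g [sf cf] [sg cg].
  have If := integrable_csupp mu_lf (smooth_fun_continuous sf) cf.
  have Ig := integrable_csupp mu_lf (smooth_fun_continuous sg) cg.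
  have Iaf : mu.-integrable [set: borel P] (EFin \o (fun x => a * f x)).
    rewrite (_ : EFin \o _ = (fun x => a%:E * (EFin \o f) x)%E); last exact/funext.
    exact: integrableZl.
  rewrite RintegralD// RintegralZl//.
  under eq_bigr do rewrite mulrDr mulrCA.
  by rewrite big_split /= -mulr_sumr; ring.
move=> x; have [U [oU Ux finU]] := mu_lf x; exists U; split=> //.
pose nu0 := mfrestr (open_borel oU) finU.
have h0 : finite_signed (fun f => \int[nu0]_x f x).
  exists nu0, (@mzero _ (borel P) R) => f B cf hB.
  by rewrite [X in _ - X](_ : _ = 0) ?subr0// /Rintegral integral_measure_zero.
have [nu hnu] := finite_signed_charge (finite_signed_add_diracs s h0).
exists nu => f [sf cf] fU.
have [B _ hB] := csupp_norm_bounded (smooth_fun_continuous sf) cf.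
rewrite -(hnu f B (smooth_fun_continuous sf) hB); congr (_ + _).
by rewrite Rintegral_restr.
Qed.

End signed.

Theorem proposition9 (R : realType) (n : nat) (P : ptopologicalType)
  (hausP : hausdorff_space P) (countP : @second_countable P)
  (S : smooth_structure R n P)
  (mu : {measure set (borel P) -> \bar R}) (mu_lf : locally_finite_measure mu)
  (eta : (P -> R) -> R) (eta_distr : distribution S eta) :
  exists (a b : R) (mus : R -> (P -> R) -> R),
    [/\ a < 0 /\ 0 < b,
        forall s, a < s < b -> signed_measure S (mus s),
        forall f, test_function S f -> mus 0 f = \int[mu]_x f x &
        forall f, test_function S f ->
          is_derive (0 : R) (1 : R) (fun s : R => mus s f) (eta f)].
Proof.
have [pts hpts] := distribution_dirac_cvg hausP countP eta_distr.
(* Any rank that tends to infinity as [s] tends to 0 would do; its value at 0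
   is multiplied by 0. *)
pose m (s : R) : nat := Num.bound (`|s|^-1).
pose mus (s : R) (f : P -> R) : R :=
  \int[mu]_x f x + s * \sum_(q <- pts (m s)) q.1 * f q.2.
have mus0 f : mus 0 f = \int[mu]_x f x by rewrite /mus mul0r addr0.
exists (-1), 1, mus; split.
- by rewrite ltrN10 ltr01.
- move=> s _.
  rewrite (_ : mus s = fun f => \int[mu]_x f x +
      \sum_(q <- [seq (s * q.1, q.2) | q <- pts (m s)]) q.1 * f q.2).
    exact: signed_measure_add_diracs.
  apply/funext => f; rewrite /mus big_map mulr_sumr; congr (_ + _).
  by apply: eq_bigr => q _; rewrite mulrA.
- by move=> f _; exact: mus0.
move=> f tf.
have cm : m @ (0 : R)^' --> \oo.
  move=> A [N _ hA].
  have hN : \forall s \near (0 : R)^', (N <= m s)%N; last by apply: filterS hN => s /hA.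
  near=> s.
  have s0 : s != 0 by near: s; exact: nbhs_dnbhs_neq.
  have sN : `|s| < N.+1%:R^-1 by near: s; apply: dnbhs0_lt; rewrite invr_gt0.
  have : N.+1%:R < (m s)%:R :> R.
    apply: (lt_trans _ (archi_boundP _)); last by rewrite invr_ge0.
    by rewrite -[ltLHS]invrK ltf_pV2// posrE ?normr_gt0// invr_gt0.
  by rewrite ltr_nat => /ltnW/ltnW.
have cT := cvg_comp _ _ cm (hpts f tf).
pose quot (h : R) : R := h^-1 *: (mus (h *: 1 + 0) f - mus 0 f).
have quotE : {near (0 : R)^', (fun h => \sum_(q <- pts (m h)) q.1 * f q.2) =1 quot}.
  near=> h.
  have h0 : h != 0 by near: h; exact: nbhs_dnbhs_neq.
  rewrite /quot addr0 [_%:A]mulr1 mus0 /mus [X in _ *: X]addrC addKr.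
  by rewrite -[RHS]/(_ * _) mulrA mulVf// mul1r.
have E : quot @ (0 : R)^' --> eta f by exact: cvg_trans (near_eq_cvg quotE) cT.
by split; [exact: (cvgP _ E)|exact: (cvg_lim (@norm_hausdorff _ _) E)].
Unshelve. all: by end_near. Qed.
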